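(* Let $1<p\le q<\infty$ and let $\alpha\in(0,n)$ satisfy $\frac{\alpha}{n}=\frac1p-\frac1q$. Let $\varphi,\psi\in\Phi_{\mathrm w}(\mathbb{R}^n)$ be such that $$\varphi^{-1}(x,t)\approx t^{\frac{\alpha}{n}}\psi^{-1}(x,t).$$ Let $r\in(\frac{\alpha}{n},\frac1p]$ and assume that $\varphi$ satisfies (A0), (A1), (A2), (aInc)$_p$ and (aDec)$_{1/r}$. Then the fractional maximal operator $M_\alpha: L^\varphi(\mathbb{R}^n)\to L^\psi(\mathbb{R}^n)$ is bounded, i.e. there is a constant $C$ such that $\|M_\alpha f\|_{L^\psi(\mathbb{R}^n)}\le C\|f\|_{L^\varphi(\mathbb{R}^n)}$ for all $f\in L^\varphi(\mathbb{R}^n)$.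
   Context: Weak $\Phi$-functions: $\varphi:\mathbb{R}^n\times[0,\infty)\to[0,\infty]$ belongs to $\Phi_{\mathrm w}(\mathbb{R}^n)$ if (i) $x\mapsto\varphi(x,|f(x)|)$ is measurable for every measurable $f:\mathbb{R}^n\to\mathbb{R}$ and $t\mapsto\varphi(x,t)$ is non-decreasing for every $x$; (ii) $\varphi(x,0)=\lim_{t\to0^+}\varphi(x,t)=0$ and $\lim_{t\to\infty}\varphi(x,t)=\infty$ for every $x$; (iii) $t\mapsto\varphi(x,t)/t$ is $L$-almost increasing on $(0,\infty)$ with $L\ge1$ independent of $x$. Here $g$ is $L$-almost increasing if $g(s)\le Lg(t)$ for all $s<t$, and $L$-almost decreasing if $g(t)\le L g(s)$ for all $s<t$. A function in $\Phi_{\mathrm w}$ not depending on $x$ is also called a weak $\Phi$-function (written $\Phi_{\mathrm w}$). Generalized inverse: $\varphi^{-1}(x,t)=\inf\{\tau\ge0:\varphi(x,\tau)\ge t\}$. The relation $\varphi^{-1}(x,t)\approx t^{\alpha/n}\psi^{-1}(x,t)$ means that each side is bounded by a constant times the other, with constants independent of $t\ge0$ and of (almost every) $x$. Conditions on $\varphi$. (aInc)$_p$: $t\mapsto\varphi(x,t)/t^p$ is $L_p$-almost increasing on $(0,\infty)$ for a.e. $x$, with $L_p\ge1$ independent of $x$. (aDec)$_q$: $t\mapsto\varphi(x,t)/t^q$ is $L_q$-almost decreasing on $(0,\infty)$ for a.e. $x$, with $L_q\ge1$ independent of $x$. (A0): there is $\beta\in(0,1]$ with $\beta\le\varphi^{-1}(x,1)\le\frac1\beta$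 for a.e. $x$. (A1): there is $\beta\in(0,1)$ with $\beta\varphi^{-1}(x,t)\le\varphi^{-1}(y,t)$ for every cube $Q$ with $|Q|\le1$, a.e. $x,y\in Q$ and every $t\in[1,\frac1{|Q|}]$. (A2): there are $\varphi_\infty\in\Phi_{\mathrm w}$ (independent of $x$), $h\in L^1(\mathbb{R}^n)\cap L^\infty(\mathbb{R}^n)$, $\beta\in(0,1]$ and $s>0$ such that for a.e. $x$: $\varphi(x,\beta t)\le\varphi_\infty(t)+h(x)$ whenever $\varphi_\infty(t)\in[0,s]$, and $\varphi_\infty(\beta t)\le\varphi(x,t)+h(x)$ whenever $\varphi(x,t)\in[0,s]$. Generalized Orlicz space: $L^\varphi(\mathbb{R}^n)$ is the set of measurable $f$ with $\int_{\mathbb{R}^n}\varphi(x,\lambda|f(x)|)\,dx<\infty$ for some $\lambda>0$, with (quasi)norm $\|f\|_{L^\varphi}=\inf\{\lambda>0:\int_{\mathbb{R}^n}\varphi(x,|f(x)|/\lambda)\,dx\le1\}$. Cubes have sides parallel to the coordinate axes. The fractional maximal function is $M_\alpha f(x)=\sup_{Q\ni x}\frac{1}{|Q|^{1-\alpha/n}}\int_Q|f(y)|\,dy$, the supremum being over all cubes $Q$ containing $x$. *)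

(* Defs.v *)
From HB Require Import structures.
From mathcomp Require Import all_boot all_order all_algebra.
From mathcomp Require Import all_classical all_reals all_analysis.
From mathcomp Require Import measurable_realfun.
Set Implicit Arguments.
Unset Strict Implicit.
Unset Printing Implicit Defensive.
Import Order.TTheory GRing.Theory Num.Theory.
Import numFieldNormedType.Exports.
Local Open Scope classical_set_scope.
Local Open Scope ring_scope.
Local Open Scope ereal_scope.

(* The Lebesgue measure of R^n on Borel sets, as the iterated product of the
   one-dimensional Lebesgue measure, transported from R * R^n to R^n.+1. *)
Fixpoint borel_leb (R : realType) (n : nat) :
    set (n.-tuple (measurableTypeR R)) -> \bar R :=
  match n with
  | 0 => fun A => \d_([tuple] : 0.-tuple (measurableTypeR R)) A
  | m.+1 => pushforward (@lebesgue_measure R \x @borel_leb R m)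
              (fun z => [the m.+1.-tuple (measurableTypeR R) of z.1 :: z.2])
  end.

Section borel_leb_measure.
Variable R : realType.
Let mR := measurableTypeR R.

Let measurable_pcons m : measurable_fun [set: mR * m.-tuple mR]
  (fun z => [the m.+1.-tuple mR of z.1 :: z.2]).
Proof. exact: measurable_cons. Qed.

Let sigma_finite_prod d1 d2 (T1 : measurableType d1) (T2 : measurableType d2)
    (m1 : {sigma_finite_measure set T1 -> \bar R})
    (m2 : {sigma_finite_measure set T2 -> \bar R}) :
  sigma_finite setT (m1 \x m2).
Proof.
have /sigma_finiteP[F [TF ndF Foo]] := sigma_finiteT m1.
have /sigma_finiteP[G [TG ndG Goo]] := sigma_finiteT m2.
exists (fun n => F n `*` G n).
  rewrite -setXTT TF TG predeqE => -[x y]; split.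
    move=> [/= [n _ Fnx] [k _ Gky]]; exists (maxn n k) => //; split.
    - by move: x Fnx; exact/subsetPset/ndF/leq_maxl.
    - by move: y Gky; exact/subsetPset/ndG/leq_maxr.
  by move=> [n _ []/= ? ?]; split; exists n.
move=> k; have [? ?] := Foo k; have [? ?] := Goo k.
split; first exact: measurableX.
by rewrite product_measure1E// lte_mul_pinfty// ge0_fin_numE.
Qed.

Let borel_leb_ex (n : nat) :
  exists m : {sigma_finite_measure set (n.-tuple mR) -> \bar R},
    borel_leb (R := R) (n := n) = m :> (_ -> _).
Proof.
elim: n => [|n [m IH]].
  by exists (\d_([tuple] : 0.-tuple mR)).
pose T : measurableType _ := n.+1.-tuple mR.
pose mu : set T -> \bar R := pushforward (@lebesgue_measure R \x m)
  (fun z => [the n.+1.-tuple mR of z.1 :: z.2]).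
have mu0 : mu set0 = 0 by rewrite /mu /pushforward preimage_set0 measure0.
have mu_ge0 A : 0 <= mu A by rewrite /mu /pushforward measure_ge0.
have mu_sigma : semi_sigma_additive mu.
  move=> F mF tF mUF; rewrite /mu /pushforward preimage_bigcup.
  apply: measure_semi_sigma_additive.
  - by move=> k; rewrite -[X in measurable X]setTI; exact: measurable_pcons.
  - apply/trivIsetP => i j _ _ ij; rewrite -preimage_setI.
    by move/trivIsetP : tF => /(_ _ _ _ _ ij) ->//; rewrite preimage_set0.
  - by rewrite -preimage_bigcup -[X in measurable X]setTI;
      exact: measurable_pcons.
have mu_sfin : sigma_finite setT mu.
  have [F TF Foo] := sigma_finite_prod (@lebesgue_measure R) m.
  pose dec (t : n.+1.-tuple mR) : (mR * n.-tuple mR)%type :=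
    (thead t, [tuple of behead t]).
  have mdec : measurable_fun setT dec.
    apply/measurable_fun_pair; last exact: measurable_behead.
    exact: (@measurable_tnth _ mR n.+1 ord0).
  have consK (z : (mR * n.-tuple mR)%type) :
      dec [the n.+1.-tuple mR of z.1 :: z.2] = z.
    case: z => a t; rewrite /dec /= theadE; congr pair.
    by apply/val_inj.
  exists (fun k => dec @^-1` F k).
    by rewrite -preimage_bigcup -TF preimage_setT.
  move=> k; have [mF Fk] := Foo k; split.
    by rewrite -[X in measurable X]setTI; exact: mdec.
  rewrite /mu /pushforward -comp_preimage (_ : _ \o _ = id)//.
  by apply/funext => z /=; exact: consK.
have muE : borel_leb (R := R) (n := n.+1) = mu by rewrite /= IH.
clearbody mu.
pose Mm := isMeasure.Build _ _ _ mu mu0 mu_ge0 mu_sigma.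
pose muM : {measure set _ -> \bar R} := HB.pack mu Mm.
pose Ms := Measure_isSigmaFinite.Build _ T R muM mu_sfin.
pose muS : {sigma_finite_measure set _ -> \bar R} := HB.pack mu Mm Ms.
by exists muS.
Qed.

Variable n : nat.
Local Notation leb := (borel_leb (R := R) (n := n)).

Let leb0 : leb set0 = 0.
Proof. by have [m ->] := borel_leb_ex n; rewrite measure0. Qed.

Let leb_ge0 A : 0 <= leb A.
Proof. by have [m ->] := borel_leb_ex n; exact: measure_ge0. Qed.

Let leb_sigma_additive : semi_sigma_additive leb.
Proof.
by have [m ->] := borel_leb_ex n; exact: measure_semi_sigma_additive.
Qed.

HB.instance Definition _ := isMeasure.Build _ _ _ leb
  leb0 leb_ge0 leb_sigma_additive.

Let leb_sigma_finite : sigma_finite setT leb.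
Proof. by have [m ->] := borel_leb_ex n; exact: sigma_finiteT. Qed.

HB.instance Definition _ := Measure_isSigmaFinite.Build _ _ _ leb leb_sigma_finite.

End borel_leb_measure.

(* R^n with the sigma-algebra of Lebesgue measurable sets, i.e. the
   Caratheodory sets of the outer measure induced by [borel_leb]. *)
Definition Rn (R : realType) (n : nat) : Type :=
  caratheodory_type (mu_ext (@borel_leb R n)).
HB.instance Definition _ (R : realType) (n : nat) := Measurable.on (Rn R n).

Definition Rn_coord (R : realType) (n : nat) (x : Rn R n) (i : 'I_n) : R :=
  tnth (x : n.-tuple R) i.

Definition leb (R : realType) (n : nat) : set (Rn R n) -> \bar R :=
  @completed_measure_extension _ _ R (@borel_leb R n).
HB.instance Definition _ (R : realType) (n : nat) := Measure.on (@leb R n).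

Section generalized_orlicz.
Variables (R : realType) (n : nat).
Local Notation Rn := (Rn R n).
Local Notation leb := (@leb R n).

Definition cube (a : Rn) (l : R) : set Rn :=
  [set x | forall i, (Rn_coord a i <= Rn_coord x i <= Rn_coord a i + l)%R].

Definition is_cube (Q : set Rn) : Prop :=
  exists (a : Rn) (l : R), (0 < l)%R /\ Q = cube a l.

Definition almost_increasing (L : R) (g : R -> \bar R) : Prop :=
  forall s t : R, (0 < s)%R -> (s < t)%R -> g s <= L%:E * g t.

Definition almost_decreasing (L : R) (g : R -> \bar R) : Prop :=
  forall s t : R, (0 < s)%R -> (s < t)%R -> g t <= L%:E * g s.

(* Functions R^n x [0, oo) -> [0, oo] are represented by total functions of
   t : R, of which only the values at t >= 0 are ever used. *)
Implicit Types phi psi : Rn -> R -> \bar R.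

Record weak_Phi phi : Prop := {
  weak_Phi_ge0 : forall x (t : R), (0 <= t)%R -> 0 <= phi x t;
  weak_Phi_measurable : forall f : Rn -> R, measurable_fun setT f ->
    measurable_fun setT (fun x => phi x `|f x|%R);
  weak_Phi_nondecreasing : forall x (s t : R),
    (0 <= s)%R -> (s <= t)%R -> phi x s <= phi x t;
  weak_Phi0 : forall x, phi x 0%R = 0;
  weak_Phi_cvg0 : forall x, phi x t @[t --> 0%R^'+] --> (0 : \bar R);
  weak_Phi_cvgy : forall x, phi x t @[t --> +oo%R] --> (+oo : \bar R);
  weak_Phi_aInc1 : exists L : R, (1 <= L)%R /\
    forall x, almost_increasing L (fun t => phi x t * (t^-1)%:E)
}.

(* For a weak Phi-function and a real t the set below is nonempty, so that its
   infimum is a nonnegative real number. *)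
Definition ginv phi (x : Rn) (t : R) : R :=
  inf [set tau : R | (0 <= tau)%R /\ t%:E <= phi x tau].

Definition inv_equiv (a : R) phi psi : Prop :=
  exists C : R, (0 < C)%R /\
    \forall x \ae leb, forall t : R, (0 <= t)%R ->
      (ginv phi x t <= C * (t `^ a * ginv psi x t))%R /\
      (t `^ a * ginv psi x t <= C * ginv phi x t)%R.

Definition aInc (p : R) phi : Prop :=
  exists L : R, (1 <= L)%R /\
    \forall x \ae leb,
      almost_increasing L (fun t => phi x t * ((t `^ p)^-1)%:E).

Definition aDec (q : R) phi : Prop :=
  exists L : R, (1 <= L)%R /\
    \forall x \ae leb,
      almost_decreasing L (fun t => phi x t * ((t `^ q)^-1)%:E).

Definition A0 phi : Prop :=
  exists b : R, (0 < b <= 1)%R /\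
    \forall x \ae leb, (b <= ginv phi x 1 <= b^-1)%R.

Definition A1 phi : Prop :=
  exists b : R, (0 < b < 1)%R /\
    forall Q : set Rn, is_cube Q -> leb Q <= 1 ->
    \forall x \ae leb, Q x ->
      \forall y \ae leb, Q y ->
        forall t : R, (1 <= t <= (fine (leb Q))^-1)%R ->
          (b * ginv phi x t <= ginv phi y t)%R.

Definition A2 phi : Prop :=
  exists (phi_oo : R -> \bar R) (h : Rn -> R) (b s : R),
    [/\ weak_Phi (fun=> phi_oo),
        h \in Lfun leb 1 /\ h \in Lfun leb +oo,
        (0 < b <= 1)%R,
        (0 < s)%R &
        \forall x \ae leb, forall t : R, (0 <= t)%R ->
          (phi_oo t <= s%:E -> phi x (b * t)%R <= phi_oo t + (h x)%:E) /\
          (phi x t <= s%:E -> phi_oo (b * t)%R <= phi x t + (h x)%:E)].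

(* The value of phi x at an extended real; a weak Phi-function takes the value
   +oo = lim_(t -> oo) phi x t at +oo. Needed because the maximal function may
   be infinite at some points. *)
Definition phi_ext phi (x : Rn) (e : \bar R) : \bar R :=
  if e is t%:E then phi x t else +oo.

Definition modular phi (f : Rn -> \bar R) : \bar R :=
  \int[leb]_x phi_ext phi x `|f x|.

Definition Lphi phi : set (Rn -> \bar R) :=
  [set f | measurable_fun setT f /\
    exists l : R, (0 < l)%R /\ modular phi (fun x => l%:E * f x) < +oo].

Definition Lphi_norm phi (f : Rn -> \bar R) : \bar R :=
  ereal_inf [set l%:E | l in
    [set l : R | (0 < l)%R /\ modular phi (fun x => f x * (l^-1)%:E) <= 1]].

Definition frac_maximal (alpha : R) (f : Rn -> R) (x : Rn) : \bar R :=
  ereal_sup [set v | exists Q : set Rn, [/\ is_cube Q, Q x &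
    v = ((fine (leb Q) `^ (1 - alpha / n%:R))^-1)%:E *
        \int[leb]_(y in Q) `|f y|%:E]].

End generalized_orlicz.

(* Main.v *)
(* The level of [phi] replaces its inverse throughout: since
   phi^-1(x, t) ~ t^g psi^-1(x, t) with g = alpha / n, the bounds
   phi(x, u) <= C T and u = average of |f| over Q with |Q| <= C / T give
   psi(x, c |Q|^g u) <= T.  So if the modular of f is at most 1, it suffices to
   bound phi(x, u) by C / |Q| and by a function T(x) with integral at most C.

   Put G = phi(y, |f|)^(1/p) and let M be the maximal function.  Where |f| > 1,
   Jensen's inequality for the almost increasing function phi^(1/p), with (A1)
   on small cubes, gives phi(x, u) <= C (average of G)^p.  Where |f| <= 1, (A2)
   gives the same up to the errors h(x) and (average of h^(1/p))^p, so that
   T = (M G)^p + h + (M h^(1/p))^p, which is integrable by the L^p boundedness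
   of M.  The bound by C / |Q| then fails only if h(x) > 1 / |Q|; in that case
   compare with a point z of Q where h(z) <= C / |Q|, and raise u to the level
   h(x) by (aDec)_(1/r), which costs less than the gain since g < r.

   Null sets are harmless because cubes with rational data suffice, and
   Hardy-Littlewood's inequality follows from Vitali's covering argument and
   summation over dyadic levels. *)
Require Import Defs.
From mathcomp Require Import all_boot all_order all_algebra.
From mathcomp Require Import all_classical all_reals all_analysis.
From mathcomp Require Import measurable_realfun lra ring.
Set Implicit Arguments.
Unset Strict Implicit.
Unset Printing Implicit Defensive.
Import Order.TTheory GRing.Theory Num.Theory.
Import numFieldNormedType.Exports.
Local Open Scope classical_set_scope.
Local Open Scope ring_scope.

(** * Lebesgue measure of cubes *)


(** Let e be the average of G over Q and let s be a threshold with phi(y, s) comparable to e^p.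
    Where |f| > s, (aInc)_p bounds |f| by a multiple of (s / e) G, so |f| <= s + C (s / e) G.
    Averaging gives at most C s, and (aDec) pulls the constant out of phi. The obstacle is that s
    must serve all y in Q at once. For the part above 1, (A1) provides such an s, but only at levels
    between 1 and 1 / |Q|; lower levels are covered by the uniform bounds at t = 1. For the part
    below 1, (A2) moves everything to a single point z, so that s depends on z alone, at the price
    of h(y) and h(z); their roots enter the average, whence h^(1/p).

    (A1) excludes null sets that depend on the cube and on the level, so levels are rounded to
    integers. The constants have an order: the factor in the transfer to psi depends on the ratio B
    allowed between phi(x, u) and T, hence B is fixed first. *)

Section cubes.
Variable R : realType.
Let mR := measurableTypeR R.

Definition tuple_cube n (a : n.-tuple mR) (l : R) : set (n.-tuple mR) :=
  [set x | forall i, ((tnth a i : R) <= tnth x i <= (tnth a i : R) + l)%R].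

Lemma measurable_tuple_cube n (a : n.-tuple mR) l :
  measurable (tuple_cube a l).
Proof.
rewrite (_ : tuple_cube a l = \big[setI/setT]_(i < n)
    (@tnth n mR ^~ i @^-1` [set` `[tnth a i : R, (tnth a i : R) + l]])).
  apply: bigsetI_measurable => i _; rewrite -[X in measurable X]setTI.
  by apply: measurable_tnth => //; exact: measurable_itv.
rewrite -bigcap_seq; apply/seteqP; split => x /= xa.
  by move=> i _ /=; rewrite in_itv/=; exact: xa.
by move=> i; have := xa i (mem_index_enum i); rewrite /= in_itv.
Qed.

(** By induction on the dimension: the preimage of a cube under consing a coordinate is an interval
    times a cube of one dimension less. In dimension 0 the cube is the whole one-point space, of
    Dirac mass 1 = [l ^+ 0]. *)
Lemma borel_leb_cube n (a : n.-tuple mR) l : 0 <= l ->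
  borel_leb (R := R) (n := n) (tuple_cube a l) = (l ^+ n)%:E.
Proof.
move=> l0; elim: n a => [|n IH] a.
  by rewrite expr0 /= diracE mem_set// => -[].
rewrite /= /pushforward.
have inordE (j : 'I_n) : inord j.+1 = lift ord0 j :> 'I_n.+1.
  by apply/val_inj; rewrite /= inordK// ltnS.
rewrite (_ : _ @^-1` _ = [set` `[thead a : R, (thead a : R) + l]] `*`
    tuple_cube [tuple of behead a] l); last first.
  apply/seteqP; split => -[x t] /=.
    move=> H; split => /=; first by rewrite in_itv/=; exact: (H ord0).
    by move=> i; have := H (lift ord0 i); rewrite tnth_behead inordE tnthS.
  move=> [/= H1 H2] i; case: (unliftP ord0 i) => [j ->|->].
    by have := H2 j; rewrite tnth_behead inordE tnthS.
  by move: H1; rewrite in_itv.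
rewrite product_measure1E//; last exact: measurable_tuple_cube.
rewrite exprS EFinM; congr (_ * _)%E; last exact: IH.
rewrite [LHS]lebesgue_measure_itv/= lte_fin ltrDl.
case: ltP => [_|l_le0]; first by rewrite -EFinB addrAC subrr add0r.
by congr EFin; apply/eqP; rewrite eq_le l0 l_le0.
Qed.

Variable n : nat.
Local Notation leb := (@leb R n).

Lemma measurable_cube (a : Rn R n) l : measurable (cube a l).
Proof.
apply: (@caratheodory_measurable_mu_ext _ _ _ (@borel_leb R n)).
exact: measurable_tuple_cube.
Qed.

Lemma leb_cube (a : Rn R n) l : 0 <= l -> leb (cube a l) = (l ^+ n)%:E.
Proof.
move=> l0; rewrite -(@borel_leb_cube n a l l0).
by apply: measurable_mu_extE; exact: measurable_tuple_cube.
Qed.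

End cubes.

(** * The Hardy-Littlewood maximal function of a countable Vitali family *)


Lemma powR2_gt1 (R : realType) (s : R) : 0 < s -> 1 < 2 `^ s :> R.
Proof.
move=> s0; rewrite -[ltLHS](@powRr0 _ 2) /powR gt_eqF//.
by rewrite ltr_expR ltr_pM2r// ln_gt0// ltr1n.
Qed.

Section geometric_sum.
Variables (R : realType) (s eps : R).
Hypotheses (s0 : 0 < s) (eps0 : 0 < eps).
Let rho : R := 2 `^ s.
Let c := rho / (rho - 1).

Let rho1 : 1 < rho. Proof. exact: powR2_gt1. Qed.

Let c0 : 0 <= c. Proof. by rewrite divr_ge0//; move: rho1; lra. Qed.

Let levelE k : (2 ^+ k * eps) `^ s = rho ^+ k * eps `^ s.
Proof.
rewrite powRM ?exprn_ge0 ?(ltW eps0)//.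
congr (_ * _); rewrite -(@powR_mulrn _ 2)// -powRrM mulrC powRrM.
by rewrite powR_mulrn// powR_ge0.
Qed.

Let sum_levels N : \sum_(k < N.+1) (2 ^+ k * eps) `^ s <= c * (2 ^+ N * eps) `^ s.
Proof.
elim: N => [|N IH].
  rewrite big_ord_recl big_ord0 addr0 ler_peMl ?powR_ge0//.
  by rewrite /c ler_pdivlMr ?mul1r; move: rho1; lra.
rewrite big_ord_recr/=; apply: (le_trans (lerD IH (lexx _))).
rewrite !levelE -[X in _ + X <= _]mul1r !mulrA -mulrDl ler_wpM2r ?powR_ge0//.
rewrite exprS (_ : c * (rho * rho ^+ N) = (c * rho) * rho ^+ N) ?mulrA//.
rewrite mul1r -mulrDl ler_wpM2r ?exprn_ge0//; first by move: rho1; lra.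
suff -> : c * rho = c + rho by [].
by rewrite /c; field; move: rho1; lra.
Qed.

(** The levels below [w] grow geometrically with ratio 2^s after taking powers, so their sum is at
    most a constant times the last one, itself below w^s. The constant is the sum of the series in
    2^(-s). *)
Lemma sum_dyadic_levels_le (w : R) N : 0 <= w ->
  \sum_(k < N) (if 2 ^+ k * eps < w then (2 ^+ k * eps) `^ s else 0)
  <= 2 `^ s / (2 `^ s - 1) * w `^ s.
Proof.
move=> w0; elim: N => [|N IH]; first by rewrite big_ord0 mulr_ge0// powR_ge0.
have [wN|wN] := ltP (2 ^+ N * eps) w; last first.
  by rewrite big_ord_recr/= ltNge wN/= addr0.
apply: (@le_trans _ _ (c * (2 ^+ N * eps) `^ s)).
  apply: le_trans (sum_levels N); apply: ler_sum => i _.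
  by case: ifP => // _; exact: powR_ge0.
rewrite ler_wpM2l//; apply: ge0_ler_powR; rewrite ?nnegrE ?(ltW s0) ?(ltW wN)//.
by rewrite mulr_ge0 ?exprn_ge0// ltW.
Qed.
End geometric_sum.

Section maximal_function.
Local Open Scope ereal_scope.
Context d (T : measurableType d) (R : realType) (mu : {measure set T -> \bar R}).
Variables (B : nat -> set T) (K : R).
Hypothesis mB : forall k, measurable (B k).
Hypothesis B_gt0 : forall k, 0 < mu (B k).
Hypothesis B_lty : forall k, mu (B k) < +oo.
Hypothesis vitali : forall s : seq nat, exists D : seq nat,
  [/\ uniq D, {subset D <= s}, trivIset [set` D] B &
   mu (\big[setU/set0]_(i <- s) B i) <= K%:E * \sum_(i <- D) mu (B i)].

Definition avg (f : T -> R) (k : nat) : \bar R :=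
  (fine (mu (B k)))^-1%:E * \int[mu]_(x in B k) (f x)%:E.

(** Points outside [B k] contribute 0, which is harmless for nonnegative [f]. Countability of the
    family gives measurability, and the covering property [vitali] stands in for any geometry of
    [T]. *)
Definition maxf (f : T -> R) (x : T) : \bar R :=
  ereal_sup (range (fun k => (\1_(B k) x)%:E * avg f k)).

Implicit Types (f g E : T -> R) (k : nat).

Let fineB_gt0 k : (0 < fine (mu (B k)))%R.
Proof. by rewrite fine_gt0// B_gt0 B_lty. Qed.

Let fineBK k : (fine (mu (B k)))%:E = mu (B k).
Proof. by rewrite fineK// ge0_fin_numE. Qed.

Lemma avg_ge0 f k : (forall x, 0 <= f x)%R -> 0 <= avg f k.
Proof.
move=> f0; apply: mule_ge0; first by rewrite lee_fin invr_ge0 ltW.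
by apply: integral_ge0 => x _; rewrite lee_fin.
Qed.

Lemma avgK f k : \int[mu]_(x in B k) (f x)%:E = mu (B k) * avg f k.
Proof. by rewrite /avg -[in RHS]fineBK muleA -EFinM divff ?mul1e// gt_eqF. Qed.

Lemma avg_le_maxf f k x : B k x -> avg f k <= maxf f x.
Proof.
move=> Bx; apply: ereal_sup_ubound => /=; exists k => //.
by rewrite indicE mem_set// mul1e.
Qed.

Lemma maxf_ge0 f x : (forall x, 0 <= f x)%R -> 0 <= maxf f x.
Proof.
move=> f0; apply: le_trans (ereal_sup_ubound _); last by exists 0%N.
by apply: mule_ge0 (avg_ge0 _ _) => //; rewrite lee_fin.
Qed.

Lemma measurable_maxf f : measurable_fun setT (maxf f).
Proof.
rewrite (_ : maxf f = fun x => esups (fun k => (\1_(B k) x)%:E * avg f k) 0%N).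
  apply: measurable_fun_esups => k; apply: emeasurable_funM => //.
  by apply/measurable_EFinP; exact: measurable_indic.
by apply/funext => x; rewrite /maxf /esups/= /sdrop; congr ereal_sup;
  apply/seteqP; split => [_ [k _ <-]|_ [k _ <-]]; exists k.
Qed.

(** The superlevel set is the increasing union of the sets [F N], finite unions of members with
    average above [c]. From each, [vitali] selects disjoint members; each has measure at most its
    integral divided by [c], and disjointness lets these integrals add up to at most the integral of
    [f]. *)
Lemma weak_type f (c : R) : measurable_fun setT f -> (forall x, 0 <= f x)%R ->
  (0 <= K)%R -> (0 < c)%R ->
  mu [set x | c%:E < maxf f x] <= (K / c)%:E * \int[mu]_x (f x)%:E.
Proof.
move=> mf f0 K0 c0.
have mEf : measurable_fun setT (EFin \o f) by exact/measurable_EFinP.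
pose s N := [seq k <- iota 0 N | `[< c%:E < avg f k >]].
pose F N := \big[setU/set0]_(i <- s N) B i.
have FE N : F N = \bigcup_(k in [set k | (k < N)%N /\ c%:E < avg f k]) B k.
  rewrite /F -bigcup_seq; congr (bigcup _ _); apply/seteqP; split => k /=;
    rewrite /s mem_filter mem_iota add0n /=.
    by move=> /andP[/asboolP].
  by move=> [kN ck]; apply/andP; split => //; exact/asboolP.
have mF N : measurable (F N) by apply: bigsetU_measurable => i _; exact: mB.
have setE : [set x | c%:E < maxf f x] = \bigcup_N F N.
  apply/seteqP; split => [x /= /ereal_sup_gt[_ [k _ <-]]|x [N _]].
    rewrite indicE; have [xB|xB] := boolP (x \in B k); rewrite ?mul1e ?mul0e.
      by move=> ck; exists k.+1 => //; rewrite FE; exists k => //; exact/set_mem.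
    by rewrite lte_fin ltNge (ltW c0).
  by rewrite FE => -[k [_ ck] Bx] /=; apply: lt_le_trans ck _; exact: avg_le_maxf.
rewrite setE.
have /cvg_lim <- // : mu \o F @ \oo --> mu (\bigcup_n F n).
  apply: nondecreasing_cvg_mu => //; first exact: bigcupT_measurable.
  move=> m n mn; apply/subsetPset; rewrite !FE => x [k [km ck] Bx].
  by exists k => //; split => //; exact: leq_trans mn.
apply: lime_le.
  apply: ereal_nondecreasing_is_cvgn => m n mn; apply: le_measure; rewrite ?inE//.
  rewrite !FE => x [k [km ck] Bx].
  by exists k => //; split => //; exact: leq_trans mn.
apply: nearW => N /=; have [D [uD Ds tD muD]] := vitali (s N).
apply: (le_trans muD); rewrite EFinM -muleA; apply: lee_wpmul2l => //.
apply: (@le_trans _ _ (\sum_(i <- D) c^-1%:E * \int[mu]_(x in B i) (f x)%:E)).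
  rewrite big_seq [leRHS]big_seq; apply: lee_sum => i /Ds.
  rewrite /s mem_filter => /andP[/asboolP ck _].
  rewrite -lee_pdivrMl ?invr_gt0// invrK avgK muleC.
  by apply: lee_wpmul2l => //; exact: ltW.
rewrite -ge0_sume_distrr; last first.
  by move=> i _; apply: integral_ge0 => x _; rewrite lee_fin.
apply: lee_wpmul2l; first by rewrite lee_fin invr_ge0 ltW.
rewrite -ge0_integral_bigsetU//=.
- by apply: ge0_subset_integral => //; [exact: bigsetU_measurable|
    move=> x _; rewrite lee_fin].
- exact: measurable_funTS.
- by move=> x _; rewrite lee_fin.
Qed.

(** As [f] is at most [c] plus its part above [c], an average of [f] above [2 * c] forces an average
    of that part above [c]. Keeping only this part is what makes the sum over dyadic levels
    converge. *)
Lemma weak_type_trunc f (c : R) :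
  measurable_fun setT f -> (forall x, 0 <= f x)%R -> (0 <= K)%R -> (0 < c)%R ->
  mu [set x | (2 * c)%:E < maxf f x] <=
  (K / c)%:E * \int[mu]_x (if (c < f x)%R then f x else 0%R)%:E.
Proof.
move=> mf f0 K0 c0; pose f1 x := if (c < f x)%R then f x else 0%R.
have mf1 : measurable_fun setT f1.
  by apply: measurable_fun_ifT => //; exact: measurable_fun_ltr.
have f10 x : (0 <= f1 x)%R by rewrite /f1; case: ifP.
apply: le_trans (weak_type mf1 f10 K0 c0).
apply: le_measure; rewrite ?inE.
- rewrite -[X in measurable X]setTI; apply: emeasurable_fun_o_infty => //.
  exact: measurable_maxf.
- rewrite -[X in measurable X]setTI; apply: emeasurable_fun_o_infty => //.
  exact: measurable_maxf.
move=> x /= /ereal_sup_gt[_ [k _ <-]].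
rewrite indicE; have [xB|xB] := boolP (x \in B k); rewrite ?mul1e ?mul0e; last first.
  by rewrite lte_fin ltNge mulr_ge0// ltW.
move=> ck; apply: lt_le_trans (avg_le_maxf _ (set_mem xB)).
have : avg f k <= c%:E + avg f1 k.
  rewrite {1}/avg lee_pdivrMl// fineBK ge0_muleDr//; last 2 first.
  - by rewrite lee_fin ltW.
  - exact: (avg_ge0 _ f10).
  rewrite -avgK [_ * c%:E]muleC -integral_cst//.
  rewrite -ge0_integralD//=; last 3 first.
  - by move=> y _; rewrite lee_fin ltW.
  - by move=> y _; rewrite lee_fin.
  - by apply/measurable_EFinP; exact: measurable_funTS.
  apply: ge0_le_integral => //.
  - by move=> y _; rewrite lee_fin.
  - by apply/measurable_EFinP; exact: measurable_funTS.
  - by apply: emeasurable_funD => //; apply/measurable_EFinP; exact: measurable_funTS.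
  move=> y _; rewrite -EFinD lee_fin /f1.
  by case: ltP => cf; [rewrite lerDr ltW|rewrite addr0].
move=> /(lt_le_trans ck); rewrite -lteBlDl// -EFinB => /(le_lt_trans _); apply.
by rewrite lee_fin; lra.
Qed.

Lemma avg_fin_num f k (c : R) : (forall x, 0 <= f x)%R -> avg f k <= c%:E ->
  avg f k = (fine (avg f k))%:E.
Proof.
by move=> f0 fc; rewrite fineK// ge0_fin_numE ?avg_ge0// (le_lt_trans fc)// ltry.
Qed.

(** This is the averaging half of every Jensen-type argument: an affine majorant that holds almost
    everywhere passes to averages. *)
Lemma le_avg_ae f E k (s a : R) :
  measurable_fun setT f -> (forall x, 0 <= f x)%R ->
  measurable_fun setT E -> (forall x, 0 <= E x)%R -> (0 <= s)%R -> (0 <= a)%R ->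
  {ae mu, forall x, B k x -> (f x <= s + a * E x)%R} ->
  avg f k <= s%:E + a%:E * avg E k.
Proof.
move=> mf f0 mE E0 s0 a0 fsE; have aE0 : 0 <= a%:E * avg E k.
  by rewrite mule_ge0 ?lee_fin// avg_ge0.
rewrite {1}/avg lee_pdivrMl// fineBK ge0_muleDr//.
rewrite muleCA -avgK [_ * s%:E]muleC -integral_cst// -ge0_integralZl_EFin//=; last 2 first.
- by move=> y _; rewrite lee_fin.
- by apply/measurable_EFinP; exact: measurable_funTS.
have mE' : measurable_fun (B k) (fun x => a%:E * (E x)%:E).
  apply: emeasurable_funM => //; apply/measurable_EFinP; exact: measurable_funTS.
have aEge0 x : B k x -> 0 <= a%:E * (E x)%:E by rewrite mule_ge0 ?lee_fin.
rewrite -ge0_integralD//=.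
apply: ae_ge0_le_integral => //.
- by move=> y _; rewrite lee_fin.
- by apply/measurable_EFinP; exact: measurable_funTS.
- by move=> y _; rewrite adde_ge0 ?mule_ge0 ?lee_fin.
- exact: emeasurable_funD.
Qed.

Lemma avgD f g k : measurable_fun setT f -> (forall x, 0 <= f x)%R ->
  measurable_fun setT g -> (forall x, 0 <= g x)%R ->
  avg (fun x => f x + g x)%R k = avg f k + avg g k.
Proof.
move=> mf f0 mg g0; rewrite /avg -ge0_muleDr; last 2 first.
- by apply: integral_ge0 => y _; rewrite lee_fin.
- by apply: integral_ge0 => y _; rewrite lee_fin.
rewrite -ge0_integralD//=.
- by move=> y _; rewrite lee_fin.
- by apply/measurable_EFinP; exact: measurable_funTS.
- by move=> y _; rewrite lee_fin.
- by apply/measurable_EFinP; exact: measurable_funTS.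
Qed.

(** A form of Hölder's inequality. Above a level s one has f <= s^(1-p) f^p, and s = (S / m)^(1/p)
    makes both terms of the majorant contribute at most s to the average; hence the factor 2. *)
Lemma avg_le_power f k (p S : R) :
  measurable_fun setT f -> (forall x, 0 <= f x)%R -> (1 <= p)%R -> (0 < S)%R ->
  \int[mu]_x (f x `^ p)%:E <= S%:E ->
  avg f k <= (2 * (S / fine (mu (B k))) `^ p^-1)%:E.
Proof.
move=> mf f0 p1 S0 fS; have p0 : (0 < p)%R by lra.
have m0 := fineB_gt0 k; set m := fine (mu (B k)) in m0 *.
have Sm : (0 < S / m)%R by rewrite divr_gt0.
pose s := ((S / m) `^ p^-1)%R; have s0 : (0 < s)%R by rewrite powR_gt0.
have sp : (s `^ p = S / m)%R by rewrite /s -powRrM mulVf ?gt_eqF// powRr1// ltW.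
have mfp : measurable_fun setT (fun x => f x `^ p)%R.
  exact: (measurableT_comp (measurable_powR p)).
have a0 : (0 <= s / s `^ p)%R by rewrite divr_ge0 ?powR_ge0// ltW.
have := @le_avg_ae f (fun x => f x `^ p)%R k s (s / s `^ p)%R mf f0 mfp
  (fun x => powR_ge0 _ _) (ltW s0) a0.
have H : {ae mu, forall x, B k x -> (f x <= s + s / s `^ p * f x `^ p)%R}.
  apply: aeW => x _; have [fs|/ltW sf] := leP (f x) s.
    by apply: le_trans fs _; rewrite lerDl mulr_ge0 ?powR_ge0.
  have fs1 : (1 <= f x / s)%R by rewrite ler_pdivlMr// mul1r.
  have := le1r_powR fs1 p1; rewrite ler_pdivrMr// powRM ?invr_ge0 ?(ltW s0)//.
  move=> /le_trans; apply; rewrite (_ : (s^-1 `^ p = (s `^ p)^-1)%R); last first.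
    by rewrite -(powR_inv1 (ltW s0)) -(powR_inv1 (powR_ge0 s p)) powRAC.
  have E : (f x `^ p / s `^ p * s = s / s `^ p * f x `^ p)%R by ring.
  by rewrite E lerDr ltW.
move=> /(_ H) /le_trans; apply.
have : avg (fun x => f x `^ p)%R k <= (S / m)%:E.
  rewrite /avg -/m mulrC EFinM; apply: lee_wpmul2l; first by rewrite lee_fin invr_ge0 ltW.
  apply: le_trans fS; apply: ge0_subset_integral => //; first exact/measurable_EFinP.
  by move=> x _; rewrite lee_fin powR_ge0.
have sp0 : (0 <= s / s `^ p)%R by [].
rewrite -lee_fin in sp0; move=> /(lee_wpmul2l sp0)/(leeD2l s%:E)/le_trans; apply.
rewrite -EFinM -EFinD lee_fin sp -/s divfK ?gt_eqF//.
by lra.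
Qed.

(** 4^p comes from the top of a dyadic layer, [K] from the weak-type bound, and the quotient from
    the geometric sum of the levels to the power p - 1. *)
Definition maximal_cst (p : R) : R :=
  (4 `^ p * K * (2 `^ (p - 1) / (2 `^ (p - 1) - 1)))%R.

Lemma maximal_cst_ge0 p : (0 <= K)%R -> (1 < p)%R -> (0 <= maximal_cst p)%R.
Proof.
move=> K0 p1; rewrite /maximal_cst mulr_ge0 ?divr_ge0 ?mulr_ge0 ?powR_ge0//.
by rewrite subr_ge0 ltW// powR2_gt1// subr_gt0.
Qed.

Lemma exists_dyadic_level (eps y : R) : (0 < eps)%R -> (2 * eps < y)%R ->
  exists k, (2 * (2 ^+ k * eps) < y <= 4 * (2 ^+ k * eps))%R.
Proof.
move=> eps0 epsy.
have ex : exists k, (y <= 4 * (2 ^+ k * eps))%R.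
  exists (Num.bound (y / eps)); rewrite mulrA -ler_pdivrMr//.
  have ye : (0 <= y / eps)%R by rewrite divr_ge0 ?(ltW eps0)//; move: epsy eps0; lra.
  apply: le_trans (ltW (archi_boundP ye)) _.
  apply: (@le_trans _ _ (2 ^+ Num.bound (y / eps))%R).
    by rewrite -natrX ler_nat ltnW// ltn_expl.
  by rewrite ler_peMl ?exprn_ge0//; lra.
case: (ex_minnP ex) => -[|m] ym ymin.
  by exists 0%N; rewrite ym andbT expr0 mul1r.
exists m.+1; rewrite ym andbT ltNge; apply/negP => ym1.
have /ymin : (y <= 4 * (2 ^+ m * eps))%R.
  by apply: le_trans ym1 _; rewrite exprS; lra.
by rewrite ltnn.
Qed.

(** A finite [v] above the cutoff lies in one layer, whose single term is already at least v^p; an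
    infinite [v] lies above all levels, and the terms are unbounded. The levels start at [eps],
    which explains the cutoff. *)
Lemma layer_sum (p eps : R) (v : \bar R) : (1 < p)%R -> (0 < eps)%R -> 0 <= v ->
  (if (2 * eps)%:E < v then v `^ p else 0) <=
  \sum_(k <oo) (if (2 * (2 ^+ k * eps))%:E < v
                 then ((4 * (2 ^+ k * eps)) `^ p)%:E else 0).
Proof.
move=> p1 eps0 v0; set S := (X in _ <= X).
have S0 k : 0 <= (if (2 * (2 ^+ k * eps))%:E < v
                 then ((4 * (2 ^+ k * eps)) `^ p)%:E else 0).
  by case: ifP => // _; rewrite lee_fin powR_ge0.
have le_S k : (2 * (2 ^+ k * eps))%:E < v -> ((4 * (2 ^+ k * eps)) `^ p)%:E <= S.
  move=> kv; apply: le_trans (nneseries_lim_ge k.+1 _); last by move=> *; exact: S0.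
  by rewrite big_nat_recr//= kv leeDr// sume_ge0.
have level0 k : (0 <= 4 * (2 ^+ k * eps))%R.
  by rewrite !mulr_ge0// ?exprn_ge0// ltW.
have p0 : (0 <= p)%R by move: p1; lra.
case: ifPn => [|_]; last exact: nneseries_ge0.
case: v v0 S S0 le_S => // [v v0|_] S S0 le_S epsv.
  rewrite poweR_EFin.
  have [k /andP[kv vk]] := exists_dyadic_level eps0 epsv.
  apply: le_trans (le_S k _); last by rewrite lte_fin.
  by rewrite lee_fin; apply: ge0_ler_powR; rewrite ?nnegrE.
rewrite [leLHS]poweRyr; last by rewrite gt_eqF//; move: p1; lra.
rewrite leye_eq; apply/eqP/eqyP => r r0.
(* This value exceeds [2 * eps], so it lies in a layer, and it is at least 1 and at least [r], so
   its power p is still at least [r]. *)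
have [|k /andP[_ vk]] := @exists_dyadic_level eps (r + 1 + 2 * eps) eps0.
  by move: r0; lra.
apply: le_trans (le_S k (ltry _)); rewrite lee_fin.
have y1 : (1 <= r + 1 + 2 * eps)%R by move: r0 eps0; lra.
apply: (@le_trans _ _ ((r + 1 + 2 * eps) `^ p)%R).
  by apply: le_trans (le1r_powR y1 (ltW p1)); move: eps0; lra.
by apply: ge0_ler_powR; rewrite ?nnegrE//; move: y1; lra.
Qed.

(** Sum and integral are exchanged twice, with the truncated weak-type bound applied to each layer
    in between. At a point [x] only levels below [f x] remain, and they contribute [f x] times a
    geometric sum of order (f x)^(p-1). *)
Lemma strong_type_above f (p eps : R) :
  measurable_fun setT f -> (forall x, 0 <= f x)%R -> (0 <= K)%R ->
  (1 < p)%R -> (0 < eps)%R ->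
  \int[mu]_x (if (2 * eps)%:E < maxf f x then (maxf f x) `^ p else 0) <=
  (maximal_cst p)%:E * \int[mu]_x (f x `^ p)%:E.
Proof.
move=> mf f0 K0 p1 eps0; have mM := measurable_maxf f.
pose lam k := (2 ^+ k * eps)%R.
have lam0 k : (0 < lam k)%R by rewrite mulr_gt0// exprn_gt0.
have p10 : (0 < p - 1)%R by move: p1; lra.
have mlev (c : \bar R) : measurable_fun setT (fun x => c < maxf f x).
  by apply: measurable_fun_lte.
have rho1 := powR2_gt1 p10.
apply: (@le_trans _ _ (\int[mu]_x \sum_(k <oo) (if (2 * lam k)%:E < maxf f x
                 then ((4 * lam k) `^ p)%:E else 0))).
  apply: ge0_le_integral => //.
  - by move=> x _; case: ifP => // _; exact: poweR_ge0.
  - by apply: measurable_fun_ifT => //; exact: (measurableT_comp (measurable_poweR p)).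
  - apply: ge0_emeasurable_sum => [k x _ _|k _].
      by case: ifP => // _; rewrite lee_fin powR_ge0.
    exact: measurable_fun_ifT.
  - by move=> x _; apply: layer_sum => //; exact: maxf_ge0.
rewrite integral_nneseries//=; last 2 first.
- by move=> k; exact: measurable_fun_ifT.
- by move=> k x _; case: ifP => // _; rewrite lee_fin powR_ge0.
pose g k x := ((4 `^ p * K) * (lam k `^ (p - 1) *
   (if (lam k < f x)%R then f x else 0%R)))%R.
have mg k : measurable_fun setT (g k).
  apply: measurable_funM => //; apply: measurable_funM => //.
  by apply: measurable_fun_ifT => //; exact: measurable_fun_ltr.
have g0 k x : (0 <= g k x)%R.
  by rewrite !mulr_ge0// ?powR_ge0//; case: ifP.
apply: (@le_trans _ _ (\sum_(k <oo) \int[mu]_x (g k x)%:E)).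
  apply: lee_nneseries => [k _ _|k _].
    by apply: integral_ge0 => x _; case: ifP => // _; rewrite lee_fin powR_ge0.
  rewrite [leLHS](_ : _ = ((4 * lam k) `^ p)%:E * mu [set x | (2 * lam k)%:E < maxf f x]);
    last first.
    rewrite -integral_cst; last first.
      by rewrite -[X in measurable X]setTI; apply: emeasurable_fun_o_infty.
    rewrite [RHS]integral_mkcond; apply: eq_integral => x _; rewrite patchE.
    case: ifPn => [xl|/negP xl]; first by rewrite mem_set.
    by rewrite memNset.
  rewrite [leRHS](_ : _ = \int[mu]_x ((4 `^ p * K)%:E * ((lam k `^ (p - 1))%:E *
    (if (lam k < f x)%R then f x else 0%R)%:E))) //.
  rewrite ge0_integralZl_EFin//; last 3 first.
  - by move=> x _; rewrite mule_ge0 ?lee_fin ?powR_ge0//; case: ifP.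
  - apply: emeasurable_funM => //; apply/measurable_EFinP.
    by apply: measurable_fun_ifT => //; exact: measurable_fun_ltr.
  - by rewrite mulr_ge0// powR_ge0.
  rewrite ge0_integralZl_EFin ?powR_ge0//; last 2 first.
  - by move=> x _; rewrite lee_fin; case: ifP.
  - apply/measurable_EFinP.
    by apply: measurable_fun_ifT => //; exact: measurable_fun_ltr.
  apply: le_trans (lee_wpmul2l _ (weak_type_trunc mf f0 K0 (lam0 k))) _.
    by rewrite lee_fin powR_ge0.
  rewrite !muleA -!EFinM le_eqVlt; apply/orP; left; apply/eqP; congr (_%:E * _).
  rewrite powRM// ?(ltW (lam0 k))// -(@mulr_powRB1 _ (lam k))// ?ltW//; last first.
    by move: p1; lra.
  by have := lam0 k; move=> lk; field; rewrite gt_eqF.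
rewrite -integral_nneseries//=; last 2 first.
- by move=> k; exact/measurable_EFinP.
- by move=> k x _; rewrite lee_fin.
rewrite -ge0_integralZl_EFin//=; last 3 first.
- by move=> x _; rewrite lee_fin powR_ge0.
- by apply/measurable_EFinP; apply: (measurableT_comp (measurable_powR p)).
- exact: maximal_cst_ge0.
apply: ge0_le_integral => //.
- by move=> x _; apply: nneseries_ge0 => k _ _; rewrite lee_fin.
- apply: ge0_emeasurable_sum => [k x _ _|k _]; first by rewrite lee_fin.
  exact/measurable_EFinP.
- apply: emeasurable_funM => //; apply/measurable_EFinP.
  by apply: (measurableT_comp (measurable_powR p)).
move=> x _; apply: lime_le.
  by apply: is_cvg_nneseries => k _ _; rewrite lee_fin.
apply: nearW => N; rewrite -EFinM sumEFin lee_fin big_mkord.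
rewrite /g -mulr_sumr /maximal_cst -[leRHS]mulrA ler_wpM2l//.
  by rewrite mulr_ge0// powR_ge0.
rewrite (eq_bigr (fun k : 'I_N => (if (2 ^+ k * eps < f x)%R
    then (2 ^+ k * eps) `^ (p - 1) else 0)%R * f x)%R); last first.
  by move=> k _; rewrite /lam; case: ifP; rewrite ?mulr0 ?mul0r.
rewrite -mulr_suml; apply: (le_trans (ler_wpM2r (f0 x) (sum_dyadic_levels_le p10 eps0 N (f0 x)))).
by rewrite -[leLHS]mulrA [X in (_ * X <= _)%R]mulrC mulr_powRB1//; move: p1; lra.
Qed.

(** The constant in [strong_type_above] does not depend on [eps], so the cutoff is removed by
    monotone convergence along [eps] = 1 / (m + 1). *)
Lemma maximal_function_Lp f (p : R) :
  measurable_fun setT f -> (forall x, 0 <= f x)%R -> (0 <= K)%R -> (1 < p)%R ->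
  \int[mu]_x (maxf f x) `^ p <= (maximal_cst p)%:E * \int[mu]_x (f x `^ p)%:E.
Proof.
move=> mf f0 K0 p1; have mM := measurable_maxf f.
pose h m x := if (2 * m.+1%:R^-1)%:E < maxf f x then (maxf f x) `^ p else 0.
have h0 m x : 0 <= h m x by rewrite /h; case: ifP => // _; exact: poweR_ge0.
have mh m : measurable_fun setT (h m).
  apply: measurable_fun_ifT => //; first exact: measurable_fun_lte.
  exact: (measurableT_comp (measurable_poweR p)).
have ndh x : nondecreasing_seq (h ^~ x).
  move=> a b ab; rewrite /h; case: ifPn => [xa|_]; last exact: h0.
  rewrite ifT//; apply: le_lt_trans xa; rewrite lee_fin ler_pM2l//.
  by rewrite lef_pV2 ?posrE// ler_nat.
have := @cvg_monotone_convergence _ _ _ mu _ measurableT h mh (fun m x _ => h0 m x)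
  (fun x _ => ndh x).
rewrite (_ : (fun x => limn (h ^~ x)) = (fun x => (maxf f x) `^ p)); last first.
  apply/funext => x; apply/cvg_lim => //.
  have := maxf_ge0 x f0; rewrite le_eqVlt => /predU1P[M0|M0].
    rewrite -M0 poweR0r; last by rewrite gt_eqF//; move: p1; lra.
    rewrite (_ : h ^~ x = cst 0); first exact: cvg_cst.
    apply/funext => m; rewrite /h -M0 ifF//; apply/negbTE.
    by rewrite -leNgt lee_fin mulr_ge0.
  apply: (cvg_near_cst _).
  have [r [r0 rM]] : exists r : R, (0 < r)%R /\ r%:E <= maxf f x.
    case: (maxf f x) M0 => [r||]// r0; first by exists r; rewrite -lte_fin.
    by exists 1%R; rewrite leey.
  have r20 : (0 < r / 2)%R by rewrite divr_gt0.
  near=> m; rewrite /h ifT//; apply: lt_le_trans rM.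
  rewrite lte_fin -ltr_pdivlMl// mulrC.
  by near: m; exact: (near_infty_natSinv_lt (PosNum r20)).
move=> /cvg_lim <- //; apply: lime_le.
  apply: ereal_nondecreasing_is_cvgn => m k mk; apply: ge0_le_integral => //.
  by move=> x _; exact: ndh.
by apply: nearW => m; apply: strong_type_above => //; rewrite invr_gt0.
Unshelve. all: by end_near. Qed.

End maximal_function.

(** * Cubes with rational data *)


(** Induction along the list sorted by increasing [l]: the head is smallest, so if it meets a set
    selected from the tail, that set dominates it; otherwise the head is selected too. Nonemptiness
    makes a selected set meet itself. *)
Lemma vitali_selection (R : realType) (I : eqType) (l : I -> R) (T : Type)
    (B : I -> set T) (s : seq I) : (forall i, B i !=set0) ->
  exists D : seq I, [/\ uniq D, {subset D <= s}, trivIset [set` D] B &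
    forall i, i \in s -> exists j, [/\ j \in D, B i `&` B j !=set0 & l i <= l j]].
Proof.
move=> B0.
pose LE x y := l x <= l y.
have LE_trans : transitive LE by move=> x y z; exact: le_trans.
wlog : s / sorted LE s.
  have : sorted LE (sort LE s) by apply: sort_sorted => x y; exact: le_total.
  move=> /[swap] /[apply] -[D [uD Ds tD H]]; exists D; split => //.
  - by move=> x /Ds; rewrite mem_sort.
  - by move=> i; rewrite -(mem_sort LE) => /H.
elim: s => [_|i t IH it]; first by exists [::].
have /IH[D [uD Dt tD H]] : sorted LE t by exact: path_sorted it.
have [[k [kD ki]]|K] := pselect (exists k, k \in D /\ B i `&` B k !=set0).
  exists D; split => //; first by move=> j /Dt; rewrite inE orbC => ->.
  move=> j; rewrite inE => /predU1P[->|/H//]; exists k; split => //.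
  by have /allP := order_path_min LE_trans it; apply; exact: Dt.
have iD : i \notin D by apply/negP => iD; apply: K; exists i; rewrite setIid.
exists (i :: D); split => /=; first by rewrite iD.
- by move=> x; rewrite !inE => /predU1P[->|/Dt ->]; rewrite ?eqxx ?orbT.
- move=> j k /=; rewrite !inE => /predU1P[->{j}|jD] /predU1P[->{k}|kD]//.
  + by move=> ik; exfalso; apply: K; exists k.
  + by move=> ik; exfalso; apply: K; exists j; rewrite setIC.
  + exact: tD.
- move=> j; rewrite inE => /predU1P[->|/H[k [kD jk ljk]]].
    by exists i; split; rewrite ?mem_head// setIid.
  by exists k; split => //; rewrite inE kD orbT.
Qed.

Section rational_cubes.
Variables (R : realType) (n : nat).
Local Notation leb := (@leb R n).
Local Notation Rn := (Rn R n).

Definition mk_point (a : 'I_n -> R) : Rn := [tuple a i | i < n].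

Lemma Rn_coord_mk a i : Rn_coord (mk_point a) i = a i.
Proof. exact: tnth_mktuple. Qed.

(* Codes of non-positive sides, and numbers that code nothing, denote cubes of
   side 1. *)
Definition rcube_data (k : nat) : n.-tuple rat * rat :=
  if @unpickle (n.-tuple rat * rat)%type k is Some (a, l) then if 0 < l then (a, l) else (a, 1)
  else ([tuple 0 | i < n], 1).

Definition rbase k : Rn := mk_point (fun i => ratr (tnth (rcube_data k).1 i)).
Definition rside k : R := ratr (rcube_data k).2.
Definition rcube k : set Rn := cube (rbase k) (rside k).

Lemma rside_gt0 k : 0 < rside k.
Proof.
rewrite /rside ltr0q /rcube_data; case: unpickle => [[a l]|]//.
by case: ifP.
Qed.

Lemma measurable_rcube k : measurable (rcube k).
Proof. exact: measurable_cube. Qed.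

Lemma leb_rcube k : leb (rcube k) = (rside k ^+ n)%:E.
Proof. by rewrite leb_cube// ltW// rside_gt0. Qed.

Lemma leb_rcube_gt0 k : (0 < leb (rcube k))%E.
Proof. by rewrite leb_rcube lte_fin exprn_gt0// rside_gt0. Qed.

Lemma leb_rcube_lty k : (leb (rcube k) < +oo)%E.
Proof. by rewrite leb_rcube ltry. Qed.

Lemma rcube_is_cube k : is_cube (rcube k).
Proof. by exists (rbase k), (rside k); rewrite rside_gt0. Qed.

Lemma cube_nonempty (a : Rn) (l : R) : 0 <= l -> cube a l !=set0.
Proof. by move=> l0; exists a => i; rewrite lexx lerDl. Qed.

(** A cube that meets one of at least its own side lies in the concentric triple of the latter,
    whence the factor 3^n. *)
Lemma rcube_vitali (s : seq nat) : exists D : seq nat,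
  [/\ uniq D, {subset D <= s}, trivIset [set` D] rcube &
   (leb (\big[setU/set0]_(i <- s) rcube i)
     <= (3 ^+ n)%:E * \sum_(i <- D) leb (rcube i))%E].
Proof.
have [D [uD Ds tD H]] := @vitali_selection _ _ rside _ rcube s
  (fun k => cube_nonempty (rbase k) (ltW (rside_gt0 k))).
exists D; split => //.
pose triple k := cube (mk_point (fun i => Rn_coord (rbase k) i - rside k)) (3 * rside k).
have s0 k : 0 <= rside k by rewrite ltW// rside_gt0.
apply: (@le_trans _ _ (\sum_(i <- D) leb (triple i))%E); last first.
  rewrite ge0_sume_distrr//; apply: lee_sum => i _.
  rewrite leb_rcube leb_cube ?exprMn ?EFinM//.
  by apply: mulr_ge0.
rewrite [leRHS](big_nth 0%N) big_mkord.
apply: (@content_subadditive _ _ _ leb _ (fun k => triple (nth 0%N D k))) => //.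
- by move=> k _; exact: measurable_cube.
- by apply: bigsetU_measurable => k _; exact: measurable_rcube.
rewrite -bigcup_seq => x [i /= /H[j [jD [y [yi yj]] ij]] xi].
rewrite -(bigcup_mkord (size D) (fun k => triple (nth 0%N D k))); exists (index j D); rewrite /= ?index_mem// nth_index//.
move=> c; rewrite Rn_coord_mk.
have /andP[h1 h2] := xi c; have /andP[h3 h4] := yi c; have /andP[h5 h6] := yj c.
by apply/andP; split; lra.
Qed.

(** The gap between the sides is split into two halves [e]: the base moves left by less than [e],
    and the new side exceeds [l + e], so the far faces are still covered. *)
Lemma cube_sub_rcube (a : Rn) (l l' : R) : 0 < l -> l < l' ->
  exists k, cube a l `<=` rcube k /\ rside k <= l'.
Proof.
move=> l0 ll'; pose e := (l' - l) / 2.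
have e0 : 0 < e by rewrite divr_gt0// subr_gt0.
have ee : e * 2 = l' - l by rewrite /e divfK.
have pa i : exists q : rat, Rn_coord a i - e < ratr q < Rn_coord a i.
  have /rat_in_itvoo[q] : Rn_coord a i - e < Rn_coord a i by lra.
  by rewrite in_itv/= => qa; exists q.
pose q i := projT1 (cid (pa i)); have qP i := projT2 (cid (pa i)).
have [t tP] : exists t : rat, l + e < ratr t < l'.
  have /rat_in_itvoo[t] : l + e < l' by lra.
  by rewrite in_itv/= => ta; exists t.
have t0 : 0 < t by rewrite -(ltr0q R); lra.
exists (pickle ([tuple q i | i < n], t)).
have E : rcube_data (pickle ([tuple q i | i < n], t)) = ([tuple q i | i < n], t).
  by rewrite /rcube_data pickleK t0.
split; last by rewrite /rside E/=; lra.
move=> x xa i; rewrite Rn_coord_mk /rside E/= tnth_mktuple.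
by have /andP[h1 h2] := xa i; have /andP[h3 h4] := qP i; rewrite -/(q i) in h3 h4;
  apply/andP; split; lra.
Qed.

Lemma exists_rcube (x : Rn) : exists k, rcube k x.
Proof.
have [k [xk _]] := @cube_sub_rcube x 1 2 ltr01 (ltr1n _ 2).
by exists k; apply: xk => i; rewrite lexx lerDl ler01.
Qed.

Local Open Scope ereal_scope.

Definition frac_term (g : R) (f : Rn -> R) (k : nat) : \bar R :=
  ((fine (leb (rcube k)) `^ (1 - g))^-1)%:E * \int[leb]_(y in rcube k) `|f y|%:E.

Lemma frac_term_ge0 g f k : 0 <= frac_term g f k.
Proof.
rewrite mule_ge0 ?lee_fin ?invr_ge0 ?powR_ge0//.
by apply: integral_ge0 => y _; rewrite lee_fin.
Qed.

(** Enlarging a cube to a rational one whose side is longer by a factor at most [t] costs at most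
    t^m in the normalising power, and [t] may be taken arbitrarily close to 1. *)
Lemma frac_maximalE (alpha : R) (f : Rn -> R) (x : Rn) :
  (0 < n)%N -> (alpha < n%:R)%R -> measurable_fun setT f ->
  frac_maximal alpha f x =
  ereal_sup (range (fun k => (\1_(rcube k) x)%:E * frac_term (alpha / n%:R) f k)).
Proof.
move=> n0 an mf; set S := RHS; set g := (alpha / n%:R)%R.
have n0R : (0 < n%:R :> R)%R by rewrite ltr0n.
have g1 : (g < 1)%R by rewrite /g ltr_pdivrMr// mul1r.
have mEf (A : set Rn) : measurable_fun A (fun y => `|f y|%:E).
  by apply/measurable_funTS/measurable_EFinP/measurableT_comp.
have S0 : 0 <= S.
  apply: le_trans (ereal_sup_ubound _); last by exists 0%N.
  by apply: mule_ge0 (frac_term_ge0 _ _ _); rewrite lee_fin.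
have le_S k : rcube k x -> frac_term g f k <= S.
  move=> xk; apply: ereal_sup_ubound => /=; exists k => //.
  by rewrite indicE mem_set// mul1e.
apply/eqP; rewrite eq_le; apply/andP; split; last first.
  apply: ge_ereal_sup => _ [k _ <-]; rewrite indicE.
  have [xk|xk] := boolP (x \in rcube k); rewrite ?mul1e ?mul0e.
    by apply: ereal_sup_ubound; exists (rcube k); split => //;
      [exact: rcube_is_cube|exact/set_mem].
  (* A rational cube that misses [x] contributes 0, and the term of any rational cube containing [x]
     is at least that. *)
  have [k' xk'] := exists_rcube x.
  apply: le_trans (frac_term_ge0 g f k') _.
  by apply: ereal_sup_ubound; exists (rcube k'); split => //; exact: rcube_is_cube.
apply: ge_ereal_sup => _ [_ [[a [l [l0 ->]]] xa ->]].
rewrite leb_cube ?(ltW l0)//=; set I := \int[_]_(y in cube a l) _.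
have I0 : 0 <= I by apply: integral_ge0 => y _; rewrite lee_fin.
pose m := (n%:R * (1 - g))%R.
have m0 : (0 < m)%R by rewrite mulr_gt0// subr_gt0.
have powE (s : R) : (0 <= s)%R -> ((s ^+ n) `^ (1 - g) = s `^ m)%R.
  by move=> s0; rewrite -powR_mulrn// -powRrM.
rewrite powE ?(ltW l0)//.
(* It suffices to bound every fraction [r] < 1 of the term; the enlargement [t] is then the solution
   of t^m = 1 / r. *)
apply/lee_mul01Pr => [|r /andP[r0 r1]].
  by rewrite mule_ge0// lee_fin invr_ge0 powR_ge0.
pose t := (r `^ (- m^-1))%R.
have t0 : (0 < t)%R by rewrite powR_gt0.
have tm : (t `^ m = r^-1)%R.
  by rewrite /t -powRrM mulNr mulVf ?gt_eqF// powR_inv1// ltW.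
have t1 : (1 < t)%R.
  rewrite ltNge; apply/negP => t1.
  have : (t `^ m <= 1 `^ m)%R by apply: ge0_ler_powR; rewrite ?nnegrE// ltW.
  by rewrite tm powR1 leNgt invf_gt1// r1.
have llt : (l < l * t)%R by rewrite ltr_pMr.
have [k [ak kl]] := cube_sub_rcube a l0 llt.
apply: le_trans (le_S k (ak _ xa)).
rewrite /frac_term leb_rcube/= powE ?(ltW (rside_gt0 k))// muleA -EFinM.
apply: lee_pmul => //; first by rewrite lee_fin mulr_ge0 ?invr_ge0 ?powR_ge0// ltW.
  rewrite lee_fin -[X in (X * _ <= _)%R]invrK -invfM -tm -powRM ?(ltW t0) ?(ltW l0)//.
  rewrite lef_pV2 ?posrE ?powR_gt0 ?(mulr_gt0 t0 l0) ?rside_gt0//.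
  by rewrite mulrC; apply: ge0_ler_powR; rewrite ?nnegrE ?(ltW m0) ?(ltW (rside_gt0 k))//
    mulr_ge0// ltW.
by apply: ge0_subset_integral => //; [exact: measurable_cube|exact: measurable_rcube].
Qed.

End rational_cubes.

(** * Doubling functions of one variable *)


Section power_inequalities.
Variable R : realType.
Implicit Types a b c p x y : R.

Lemma le_powR p x y : 0 <= p -> 0 <= x -> x <= y -> x `^ p <= y `^ p.
Proof.
by move=> p0 x0 xy; apply: ge0_ler_powR; rewrite ?nnegrE// (le_trans x0).
Qed.

Lemma powRVl p x : 0 <= x -> x^-1 `^ p = (x `^ p)^-1.
Proof.
by move=> x0; rewrite -(powR_inv1 x0) -(powR_inv1 (powR_ge0 x p)) powRAC.
Qed.

Lemma powRK p x : p != 0 -> 0 <= x -> (x `^ p^-1) `^ p = x.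
Proof. by move=> p0 x0; rewrite -powRrM mulVf// powRr1. Qed.

Lemma powRVK p x : p != 0 -> 0 <= x -> (x `^ p) `^ p^-1 = x.
Proof. by move=> p0 x0; rewrite -powRrM divff// powRr1. Qed.

Lemma le_of_powR p x y : 0 < p -> 0 <= x -> 0 <= y -> x `^ p <= y `^ p -> x <= y.
Proof.
move=> p0 x0 y0 xy; rewrite -(powRVK (lt0r_neq0 p0) x0) -(powRVK (lt0r_neq0 p0) y0).
by apply: le_powR => //; rewrite ?invr_ge0 ?powR_ge0// ltW.
Qed.

Lemma powR_ge1 p x : 0 <= p -> 1 <= x -> 1 <= x `^ p.
Proof. by move=> p0 x1; have := le_powR p0 ler01 x1; rewrite powR1. Qed.

Lemma powRD_superadditive p a b : 1 <= p -> 0 <= a -> 0 <= b ->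
  a `^ p + b `^ p <= (a + b) `^ p.
Proof.
move=> p1 a0 b0; have p0 : 0 < p by lra.
rewrite -(mulr_powRB1 a0 p0) -(mulr_powRB1 b0 p0) -(mulr_powRB1 (addr_ge0 a0 b0) p0) mulrDl.
by apply: lerD; apply: ler_wpM2l => //; apply: le_powR => //; lra.
Qed.

Lemma powRD3_le p a b c : 0 <= p -> 0 <= a -> 0 <= b -> 0 <= c ->
  (a + b + c) `^ p <= 3 `^ p * (a `^ p + b `^ p + c `^ p).
Proof.
move=> p0 a0 b0 c0; pose m := Num.max a (Num.max b c).
have am : a <= m by rewrite le_max lexx.
have bm : b <= m by rewrite !le_max lexx orbT.
have cm : c <= m by rewrite !le_max lexx !orbT.
have mp : m `^ p <= a `^ p + b `^ p + c `^ p.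
  have ap := powR_ge0 a p; have bp := powR_ge0 b p; have cp := powR_ge0 c p.
  rewrite /m /Num.max; case: ifP => _; last by rewrite -addrA lerDl addr_ge0.
  by case: ifP => _; [rewrite lerDr addr_ge0|rewrite addrAC lerDr addr_ge0].
apply: le_trans (ler_wpM2l (powR_ge0 3 p) mp).
rewrite -powRM ?(le_trans a0 am)//; apply: le_powR => //.
  by rewrite !addr_ge0.
by move: am bm cm; clearbody m; clear; lra.
Qed.

End power_inequalities.

(** This models phi(x, .) at a generic point: (aInc) and (aDec) in multiplicative form, without
    division by t, and (A0) as a two-sided bound at 1. Here and below [q] is the exponent of (aDec),
    later [r^-1]; it is not the [q] of the theorem. *)
Record phi_like (R : realType) (L p q b : R) (V : R -> R) : Prop := PhiLike {
  phi_like0 : V 0 = 0;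
  phi_like_nd : forall s t, 0 <= s -> s <= t -> V s <= V t;
  phi_like_inc : forall k t, 0 < k -> k <= 1 -> 0 <= t ->
    V (k * t) <= L * k `^ p * V t;
  phi_like_dec : forall k t, 1 <= k -> 0 <= t ->
    V (k * t) <= L * k `^ q * V t;
  phi_like_lo : b <= V 1;
  phi_like_hi : V 1 <= b^-1 }.

Section phi_like.
Variables (R : realType) (L p q b : R).
Hypotheses (L1 : 1 <= L) (p1 : 1 < p) (q0 : 0 < q) (b0 : 0 < b) (b1 : b <= 1).
Variable V : R -> R.
Hypothesis VP : phi_like L p q b V.

Let L0 : 0 < L. Proof. by move: L1; lra. Qed.
Let p0 : 0 < p. Proof. by move: p1; lra. Qed.
Let pn0 : p != 0. Proof. exact: lt0r_neq0. Qed.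

Lemma phi_like_ge0 t : 0 <= t -> 0 <= V t.
Proof. by move=> t0; rewrite -(phi_like0 VP); apply: (phi_like_nd VP). Qed.

Lemma phi_like_ge t : 1 <= t -> b / L * t `^ p <= V t.
Proof.
move=> t1; have t0 : 0 < t by lra.
have := phi_like_inc VP (k := t^-1) (t := t).
rewrite invr_gt0 t0 invf_le1// t1 (ltW t0) mulVf ?gt_eqF// => /(_ isT isT isT).
have tp : 0 < t `^ p by rewrite powR_gt0.
rewrite (powRVl _ (ltW t0)).
move=> /(le_trans (phi_like_lo VP)).
rewrite mulrAC ler_pdivlMr// => H.
by rewrite mulrAC ler_pdivrMr// mulrC [leRHS]mulrC; move: H; rewrite mulrC.
Qed.

Lemma phi_like_le t : 0 <= t -> t <= 1 -> V t <= L / b * t `^ p.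
Proof.
rewrite le_eqVlt => /predU1P[<- _|t0 t1].
  by rewrite (phi_like0 VP) powR0// mulr0.
have := phi_like_inc VP t0 t1 ler01; rewrite mulr1 => /le_trans; apply.
rewrite [leRHS]mulrAC ler_wpM2l ?mulr_ge0 ?powR_ge0 ?(ltW L0)//.
exact: (phi_like_hi VP).
Qed.

Lemma phi_like_gt0 t : 0 < t -> 0 < V t.
Proof.
move=> t0; have [t1|/ltW t1] := leP 1 t.
  by apply: lt_le_trans b0 (le_trans (phi_like_lo VP) _); exact: (phi_like_nd VP).
have := phi_like_dec VP (k := t^-1) (t := t).
rewrite invf_ge1// t1 (ltW t0) mulVf ?gt_eqF// => /(_ isT isT).
move=> /(le_trans (phi_like_lo VP))/(lt_le_trans b0).
by rewrite pmulr_rgt0// mulr_gt0// powR_gt0// invr_gt0.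
Qed.

Lemma phi_like_ge_inv t M : 0 <= t -> 0 <= M -> V t <= M ->
  t <= 1 + (L / b * M) `^ p^-1.
Proof.
move=> t0 M0 VM; have [t1|/ltW t1] := leP t 1.
  by apply: le_trans t1 _; rewrite lerDl powR_ge0.
suff : t <= (L / b * M) `^ p^-1 by lra.
apply: (le_of_powR p0) => //; first exact: powR_ge0.
rewrite powRK ?(mulr_ge0 (divr_ge0 (ltW L0) (ltW b0)))//.
have := le_trans (phi_like_ge t1) VM.
by rewrite -[L / b]invf_div ler_pdivlMl// divr_gt0.
Qed.

(** An approximate inverse: [V] may jump, so the level [T] need not be attained. A point [s] of the
    sublevel set beyond half of its supremum has [2 * s] outside the set, and (aDec) returns from
    [2 * s] to [s]. *)
Lemma phi_like_threshold (T : R) : 0 < T ->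
  exists s, [/\ 0 < s, V s <= T & T <= L * 2 `^ q * V s].
Proof.
move=> T0; pose A := [set t | 0 <= t /\ V t <= T].
have [t [t0 tT]] : exists t, 0 < t /\ V t <= T.
  pose t := Num.min 1 ((T / (L / b)) `^ p^-1).
  have Lb : 0 < L / b by rewrite divr_gt0.
  have t0 : 0 < t by rewrite lt_min ltr01 powR_gt0// divr_gt0.
  exists t; split => //; apply: le_trans (phi_like_le (ltW t0) _) _.
    by rewrite /t ge_min lexx.
  rewrite -ler_pdivlMl// mulrC -[leRHS](powRK pn0 (divr_ge0 (ltW T0) (ltW Lb))).
  by apply: (le_powR (ltW p0) (ltW t0)); rewrite /t ge_min lexx orbT.
have tAt : A t := conj (ltW t0) tT.
have supA : has_sup A.
  split; first by exists t.
  exists (1 + (L / b * T) `^ p^-1) => s [s0 sT].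
  exact: phi_like_ge_inv (ltW T0) sT.
have tA : t <= sup A by exact: sup_upper_bound.
have sA0 : 0 < sup A / 2 by rewrite divr_gt0// (lt_le_trans t0).
have [s [s0 sT] sA] := sup_adherent sA0 supA.
have {}s0 : 0 < s by lra.
exists s; split => //.
apply: le_trans (phi_like_dec VP (ler1n _ 2) (ltW s0)).
have [//|/ltW s2T] := leP T (V (2 * s)).
have : 2 * s <= sup A by apply: sup_upper_bound => //; split => //; lra.
by lra.
Qed.

(** (aInc)_p between s and f gives T <= V(s) <= L (s / f)^p V(f) <= L (s / f)^p G^p, and solving for
    f makes the bound linear in [G]. Together with f <= s elsewhere this is the affine majorant used
    with [le_avg_ae]. *)
Lemma phi_like_below (T s f G : R) : 0 < s -> s < f -> 0 <= G -> 0 < T ->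
  T <= V s -> V f <= G `^ p -> f <= (L / T) `^ p^-1 * s * G.
Proof.
move=> s0 sf G0 T0 Ts fG; have f0 : 0 < f by lra.
apply: (le_of_powR p0); rewrite ?(ltW f0)//.
  by rewrite !mulr_ge0 ?powR_ge0// ltW.
rewrite -mulrA powRM ?powR_ge0 ?mulr_ge0 ?(ltW s0)// powRK ?divr_ge0 ?(ltW L0) ?(ltW T0)//.
have sf0 : 0 < s / f by rewrite divr_gt0.
have sf1 : s / f <= 1 by rewrite ler_pdivrMr// mul1r ltW.
have := phi_like_inc VP sf0 sf1 (ltW f0).
rewrite divfK ?gt_eqF// => H.
have fp : 0 < f `^ p by rewrite powR_gt0.
have : T <= L * (s / f) `^ p * G `^ p.
  apply: le_trans Ts (le_trans H _); apply: ler_wpM2l => //.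
  by rewrite mulr_ge0 ?powR_ge0// ltW.
have -> : (s / f) `^ p = s `^ p / f `^ p.
  by rewrite powRM ?invr_ge0 ?(ltW s0) ?(ltW f0)// powRVl// ltW.
rewrite mulrA mulrAC ler_pdivlMr// => {}H.
rewrite powRM ?(ltW s0)// mulrAC ler_pdivlMr//.
by rewrite [f `^ p * T]mulrC !mulrA.
Qed.

End phi_like.

(** * Weak Phi-functions at almost every point *)


Section weak_Phi.
Variables (R : realType) (n : nat).
Local Notation leb := (@leb R n).
Local Notation Rn := (Rn R n).
Implicit Types phi psi : Rn -> R -> \bar R.

Lemma ae_exists (Q : set Rn) (P : Rn -> Prop) : measurable Q -> (0 < leb Q)%E ->
  (\forall x \ae leb, Q x -> P x) -> exists2 x, Q x & P x.
Proof.
move=> mQ Q0 [N [mN N0 QN]]; apply: contrapT => H.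
have : (leb Q <= leb N)%E.
  apply: le_measure; rewrite ?inE// => x Qx; apply: QN => /= QP.
  by apply: H; exists x => //; exact: QP.
by rewrite N0 leNgt Q0.
Qed.

Lemma ginv_nonempty phi x (t : R) : weak_Phi phi ->
  [set tau : R | 0 <= tau /\ (t%:E <= phi x tau)%E] !=set0.
Proof.
move=> wphi; have /cvgeyPge/(_ t) := weak_Phi_cvgy wphi x.
move=> [M [_ HM]]; exists (Num.max 0 (M + 1)); split; first by rewrite le_max lexx.
by apply: HM; rewrite lt_max ltrDl ltr01 orbT.
Qed.

Lemma ginv_le phi x (t s : R) : 0 <= s -> (t%:E <= phi x s)%E -> ginv phi x t <= s.
Proof. by move=> s0 ts; apply: ge_inf => //; exists 0 => ? []. Qed.

Lemma lt_ginv phi x (t s : R) : 0 <= s -> s < ginv phi x t -> (phi x s < t%:E)%E.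
Proof.
by move=> s0; rewrite ltNge => /negP st; rewrite ltNge; apply/negP => ts;
  apply: st; exact: ginv_le.
Qed.

(** The infimum need not be attained, so a strict margin is required; the factors 2 in later
    constants provide it. *)
Lemma ginv_lt phi x (t s : R) : weak_Phi phi -> ginv phi x t < s ->
  (t%:E <= phi x s)%E.
Proof.
move=> wphi ts.
have hi : has_inf [set tau : R | 0 <= tau /\ (t%:E <= phi x tau)%E].
  by split; [exact: ginv_nonempty|exists 0 => ? []].
have s0 : 0 < s - ginv phi x t by rewrite subr_gt0.
have [u [u0 tu] us] := inf_adherent s0 hi.
apply: le_trans tu _; apply: (weak_Phi_nondecreasing wphi) => //.
by apply/ltW/(lt_le_trans us); rewrite /ginv addrC subrK.
Qed.

Lemma le_ginv phi x (t s : R) : weak_Phi phi -> 0 <= s -> (phi x s < t%:E)%E ->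
  s <= ginv phi x t.
Proof.
move=> wphi s0 st; rewrite leNgt; apply/negP => /(ginv_lt wphi).
by rewrite leNgt st.
Qed.

Definition phiv phi (x : Rn) (t : R) : R := fine (phi x t).

Definition good (L p q b : R) phi (x : Rn) : Prop :=
  phi_like L p q b (phiv phi x) /\
  forall t, 0 <= t -> phi x t = (phiv phi x t)%:E.

(** (A0) controls only the inverse at 1: it puts the value at [2 / b0] above 1 and the value at
    [b0 / 2] below 1. (aDec) carries both bounds to the argument 1 at the cost of the factor [K]. *)
Lemma ae_good phi (p q : R) : weak_Phi phi -> 0 < p -> 0 < q ->
  A0 phi -> aInc p phi -> aDec q phi ->
  exists L b : R, [/\ 1 <= L, 0 < b, b <= 1 & \forall x \ae leb, good L p q b phi x].
Proof.
move=> wphi p0 q0 [b0 [/andP[b00 b01] HA0]] [L1 [L11 Hinc]] [L2 [L21 Hdec]].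
pose L := Num.max L1 L2.
have LL1 : L1 <= L by rewrite le_max lexx.
have LL2 : L2 <= L by rewrite le_max lexx orbT.
have Lge1 : 1 <= L by apply: le_trans LL1.
have L0 : 0 <= L by lra.
have b02 : 1 <= 2 / b0 by rewrite ler_pdivlMr//; lra.
pose K := L * (2 / b0) `^ q.
have K1 : 1 <= K.
  by rewrite -[leLHS]mulr1; apply: ler_pM => //; apply: powR_ge1 => //; exact: ltW.
exists L, K^-1; split => //.
- by rewrite invr_gt0; lra.
- by rewrite invf_le1//; lra.
apply: filterS3 HA0 Hinc Hdec => x /andP[HA0 HA0'] Hinc Hdec.
(* [phi x] tends to 0 at 0, hence is finite at some small [s]; (aDec) propagates finiteness from [s]
   to all larger arguments. *)
have fin t : 0 <= t -> phi x t = (phiv phi x t)%:E.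
  rewrite le_eqVlt => /predU1P[<-|t0]; first by rewrite /phiv (weak_Phi0 wphi).
  rewrite /phiv fineK// ge0_fin_numE ?(weak_Phi_ge0 wphi) ?(ltW t0)//.
  have /fine_cvgP[[e /= e0 He] _] := weak_Phi_cvg0 wphi x.
  pose s := Num.min e t / 2.
  have et0 : 0 < Num.min e t by rewrite lt_min e0.
  have s0 : 0 < s by rewrite divr_gt0.
  have [se st] : s < e /\ s < t.
    have : s < Num.min e t by rewrite /s ltr_pdivrMr// ltr_pMr//; lra.
    by rewrite lt_min => /andP[].
  have sfin : phi x s \is a fin_num.
    by apply: He => //; rewrite /ball/= sub0r normrN gtr0_norm.
  have := Hdec s t s0 st; rewrite ltNge leye_eq; apply: contraTN => /eqP ->.
  rewrite gt0_mulye ?lte_fin ?invr_gt0 ?powR_gt0// leye_eq.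
  by rewrite -(fineK sfin) -!EFinM.
have V0 : phiv phi x 0 = 0 by rewrite /phiv (weak_Phi0 wphi).
have Vnd s t : 0 <= s -> s <= t -> phiv phi x s <= phiv phi x t.
  move=> s0 st; rewrite -lee_fin -!fin//; last exact: le_trans st.
  exact: (weak_Phi_nondecreasing wphi).
have Vge0 t : 0 <= t -> 0 <= phiv phi x t by move=> t0; rewrite -V0; exact: Vnd.
have Vinc k t : 0 < k -> k <= 1 -> 0 <= t ->
    phiv phi x (k * t) <= L * k `^ p * phiv phi x t.
  move=> k0; rewrite le_eqVlt => /predU1P[-> t0|k1].
    by rewrite mul1r powR1 mulr1 ler_peMl// Vge0.
  rewrite le_eqVlt => /predU1P[<-|t0]; first by rewrite mulr0 V0 mulr0.
  have kt0 : 0 < k * t by rewrite mulr_gt0.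
  have := Hinc (k * t) t kt0; rewrite gtr_pMl// => /(_ k1).
  rewrite !fin ?(ltW t0) ?(ltW kt0)// -!EFinM lee_fin.
  rewrite ler_pdivrMr ?powR_gt0// powRM ?(ltW k0) ?(ltW t0)// => /le_trans; apply.
  have tp : 0 < t `^ p by rewrite powR_gt0.
  rewrite [leLHS](_ : _ = L1 * (k `^ p * phiv phi x t)).
    by rewrite -mulrA ler_wpM2r// mulr_ge0 ?powR_ge0 ?Vge0// ltW.
  by field; rewrite gt_eqF.
have Vdec k t : 1 <= k -> 0 <= t ->
    phiv phi x (k * t) <= L * k `^ q * phiv phi x t.
  rewrite le_eqVlt => /predU1P[<- t0|k1].
    by rewrite mul1r powR1 mulr1 ler_peMl// Vge0.
  rewrite le_eqVlt => /predU1P[<-|t0]; first by rewrite mulr0 V0 mulr0.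
  have k0 : 0 < k by lra.
  have kt0 : 0 < k * t by rewrite mulr_gt0.
  have := Hdec t (k * t) t0; rewrite ltr_pMl// => /(_ k1).
  rewrite !fin ?(ltW t0) ?(ltW kt0)// -!EFinM lee_fin.
  rewrite ler_pdivrMr ?powR_gt0// powRM ?(ltW k0) ?(ltW t0)// => /le_trans; apply.
  have tp : 0 < t `^ q by rewrite powR_gt0.
  rewrite [leLHS](_ : _ = L2 * (k `^ q * phiv phi x t)).
    by rewrite -mulrA ler_wpM2r// mulr_ge0 ?powR_ge0 ?Vge0// ltW.
  by field; rewrite gt_eqF.
split=> //; split => //.
- have : (1%:E <= phi x (2 / b0)%R)%E.
    apply: (ginv_lt wphi); apply: le_lt_trans HA0' _.
    by rewrite mulrC ltr_pMr ?invr_gt0//; lra.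
  rewrite fin; last by lra.
  have := Vdec (2 / b0) 1 b02 ler01; rewrite mulr1 lee_fin => H /le_trans/(_ H).
  by rewrite -[K^-1]mulr1 ler_pdivrMl//; lra.
- rewrite invrK; have b2 : 0 <= b0 / 2 by lra.
  have : (phi x (b0 / 2)%R < 1%:E)%E by apply: lt_ginv => //; lra.
  rewrite fin// lte_fin => H.
  have := Vdec (2 / b0) (b0 / 2) b02 b2.
  rewrite mulrA divfK ?gt_eqF// divff// => /le_trans; apply.
  by rewrite -/K -[leRHS]mulr1 ler_wpM2l//; lra.
Qed.

(** Shrinking s by [k], where L k^p B = 1/2, brings phi strictly below T, so k s is at most the
    inverse of phi at T, and the equivalence compares it with T^g times the inverse of psi. The
    factor 2 in the witness then gives an argument strictly below that inverse. *)
Lemma psi_transfer phi psi (L p q b g B : R) :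
  weak_Phi phi -> weak_Phi psi -> 1 <= L -> 1 < p ->
  inv_equiv g phi psi -> 1 <= B ->
  exists2 c : R, 0 < c & \forall x \ae leb, good L p q b phi x ->
    forall s T : R, 0 <= s -> 0 < T -> phiv phi x s <= B * T ->
      (psi x (c * s / T `^ g)%R <= T%:E)%E.
Proof.
move=> wphi wpsi L1 p1 [C [C0 HC]] B1.
have p0 : 0 < p by lra.
have LB : 1 <= L * B by rewrite -[leLHS]mulr1; apply: ler_pM.
pose k := (2 * (L * B))^-1 `^ p^-1.
have LB2 : 0 < 2 * (L * B) by lra.
have k0 : 0 < k by rewrite powR_gt0// invr_gt0.
have kp : k `^ p = (2 * (L * B))^-1 by rewrite powRK ?lt0r_neq0// invr_ge0 ltW.
have k1 : k <= 1.
  apply: (le_of_powR p0) => //; first exact: ltW.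
  by rewrite kp powR1 invf_le1//; lra.
exists (k / (2 * C)); first by rewrite divr_gt0// mulr_gt0.
apply: filterS HC => x HC [VP fin] s T s0 T0 sT.
have [->|s_neq0] := eqVneq s 0.
  by rewrite mulr0 mul0r (weak_Phi0 wpsi) lee_fin ltW.
have {s_neq0}s0 : 0 < s by rewrite lt_neqAle eq_sym s_neq0.
have Tg : 0 < T `^ g by rewrite powR_gt0.
have ks0 : 0 < k * s by rewrite mulr_gt0.
apply/ltW/lt_ginv; first by rewrite divr_ge0 ?(ltW Tg)// mulr_ge0 ?(ltW s0)// divr_ge0 ?(ltW k0)//; lra.
have [H _] := HC T (ltW T0).
have : k * s <= ginv phi x T.
  apply: le_ginv => //; first exact: ltW.
  rewrite fin ?(ltW ks0)// lte_fin.
  apply: le_lt_trans (phi_like_inc VP k0 k1 (ltW s0)) _.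
  have Lk : 0 <= L * k `^ p by rewrite mulr_ge0 ?powR_ge0//; lra.
  apply: le_lt_trans (ler_wpM2l Lk sT) _.
  rewrite kp (_ : L * (2 * (L * B))^-1 * (B * T) = T / 2); first by lra.
  by field; rewrite !gt_eqF//; lra.
move=> /le_trans/(_ H) {}H.
have TC : 0 < T `^ g * C by rewrite mulr_gt0.
have : k * s / (T `^ g * C) <= ginv psi x T.
  rewrite ler_pdivrMr//; apply: le_trans H _.
  by rewrite le_eqVlt; apply/orP; left; apply/eqP; ring.
apply: lt_le_trans.
rewrite (_ : k / (2 * C) * s / T `^ g = k * s / (T `^ g * C) / 2).
  have : 0 < k * s / (T `^ g * C) by rewrite divr_gt0.
  by lra.
by field; rewrite !gt_eqF.
Qed.

(** (A2) at x and then at y compares the two points through [phi_oo]; the loss of [b' * b'] in the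
    argument is undone by (aDec). The set [N] consists of the points where the inequalities of (A2)
    hold, so no null set depends on a pair of points. *)
Lemma A2_good phi (L p q b : R) : weak_Phi phi -> 1 <= L -> 1 < p -> 0 < q ->
  0 < b -> A2 phi ->
  exists h : Rn -> R, [/\ measurable_fun setT h,
    (forall x, 0 <= h x <= 1), (\int[leb]_x (h x)%:E < +oo)%E &
    forall t0 : R, exists2 D : R, 1 <= D & exists2 N : set Rn, (\forall x \ae leb, N x) &
      forall x y, N x -> N y -> good L p q b phi x -> good L p q b phi y ->
      forall t, 0 <= t -> t <= t0 -> phiv phi x t <= D * (phiv phi y t + h x + h y)].
Proof.
move=> wphi L1 p1 q0 b0 [phi_oo [h [b' [s [wphi_oo [h1 _] /andP[b'0 b'1] s0 HA2]]]]].
have p0 : 0 < p by lra.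
have mh : measurable_fun setT h.
  by move: h1; rewrite inE => /andP[/=]; rewrite inE.
have mmin : measurable_fun setT (fun x : Rn => Num.min `|h x| 1).
  apply: (measurable_minr (f := fun x : Rn => `|h x|) (g := cst 1)).
    exact: measurableT_comp.
  exact: measurable_cst.
exists (fun x => Num.min `|h x| 1); split => //.
- by move=> x; rewrite le_min normr_ge0 ler01 ge_min lexx orbT.
- have int_h : (\int[leb]_x `|h x|%:E < +oo)%E.
    move: h1; rewrite inE => /andP[_ /=]; rewrite inE /= /finite_norm.
    by rewrite Lnorm1.
  refine (le_lt_trans _ int_h); apply: ge0_le_integral; first exact: measurableT.
  + by move=> x _; rewrite lee_fin le_min normr_ge0 ler01.
  + exact/measurable_EFinP.
  + by apply/measurable_EFinP/measurableT_comp.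
  + by move=> x _; rewrite lee_fin ge_min lexx.
move=> t0.
have bL : 0 < b / L * s by rewrite mulr_gt0// divr_gt0//; lra.
(* Up to [c], both [phi_oo] and every good [V] stay below [s], so (A2) applies. Larger arguments up
   to [t0] are divided by [r] and brought back by (aDec). *)
have [c [c0 c1 cs cphi]] : exists c : R, [/\ 0 < c, c <= 1, L / b * c `^ p <= s &
    (phi_oo c <= s%:E)%E].
  have /fine_cvgP[[e1 /= e10 He1] /cvgrPdist_le/(_ s s0)[e2 /= e20 He2]] :=
    weak_Phi_cvg0 wphi_oo (point : Rn).
  pose m := Num.min (Num.min e1 e2) (Num.min 1 ((b / L * s) `^ p^-1)).
  have m0 : 0 < m by rewrite !lt_min e10 e20 ltr01 powR_gt0.
  have c0 : 0 < m / 2 by rewrite divr_gt0.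
  have : m / 2 < m by rewrite ltr_pdivrMr// ltr_pMr//; lra.
  rewrite !lt_min => /andP[/andP[ce1 ce2] /andP[c1 cp]].
  exists (m / 2); split => //; first exact: ltW.
    rewrite -[L / b]invf_div ler_pdivrMl ?divr_gt0//; last by lra.
    rewrite -[leRHS](@powRK _ p) ?lt0r_neq0 ?(ltW bL)//.
    by apply: le_powR; rewrite ?(ltW p0) ?(ltW c0) ?(ltW cp).
  have cfin : phi_oo (m / 2) \is a fin_num.
    by apply: He1 => //; rewrite /ball/= sub0r normrN gtr0_norm.
  have := He2 (m / 2); rewrite /ball/= !sub0r !normrN gtr0_norm// => /(_ ce2 c0).
  by rewrite -(fineK cfin) lee_fin => /(le_trans (ler_norm _)).
pose r := Num.max 1 (t0 / c).
have r1 : 1 <= r by rewrite le_max lexx.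
have r0 : 0 < r by lra.
pose K1 := L * (b' * b')^-1 `^ q.
pose K2 := Num.max K1 s.
have bb0 : 0 < b' * b' by rewrite mulr_gt0.
have bb1 : 1 <= (b' * b')^-1 by rewrite invf_ge1// mulr_ile1// ltW.
have K1ge1 : 1 <= K1.
  by rewrite -[leLHS]mulr1; apply: ler_pM => //; apply: powR_ge1 => //; exact: ltW.
have K12 : K1 <= K2 by rewrite le_max lexx.
have sK2 : s <= K2 by rewrite le_max lexx orbT.
have Lr : 1 <= L * r `^ q.
  by rewrite -[leLHS]mulr1; apply: ler_pM => //; apply: powR_ge1 => //; exact: ltW.
exists (L * r `^ q * K2).
  by rewrite -[leLHS]mulr1; apply: ler_pM => //; lra.
exists [set x | forall t : R, 0 <= t ->
          ((phi_oo t <= s%:E -> phi x (b' * t)%R <= phi_oo t + (h x)%:E) /\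
          (phi x t <= s%:E -> phi_oo (b' * t)%R <= phi x t + (h x)%:E))%E] => //.
move=> x y Nx Ny [VPx finx] [VPy finy] t t_ge0 tt0.
have Vx0 := phi_like_ge0 VPx; have Vy0 := phi_like_ge0 VPy.
pose u := t / r.
have u0 : 0 <= u by rewrite divr_ge0// ltW.
have ut : u <= t by rewrite ler_pdivrMr// ler_peMr.
have uc : u <= c.
  rewrite ler_pdivrMr// (le_trans tt0)// mulrC -ler_pdivrMr//.
  by rewrite le_max lexx orbT.
have -> : t = r * u by rewrite mulrC divfK// gt_eqF.
have Vs z : good L p q b phi z -> phiv phi z u <= s.
  move=> [VPz _]; apply: le_trans (phi_like_nd VPz u0 uc) _.
  exact: le_trans (phi_like_le L1 p1 VPz (ltW c0) c1) cs.
apply: le_trans (phi_like_dec VPx r1 u0) _.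
rewrite -[leRHS]mulrA ler_wpM2l//; first by lra.
have hx0 := normr_ge0 (h x); have hy0 := normr_ge0 (h y).
have hx := ler_norm (h x); have hy := ler_norm (h y).
have Vyu : phiv phi y u <= phiv phi y (r * u).
  by apply: (phi_like_nd VPy) => //; rewrite ler_peMl.
have Vyu0 := Vy0 _ u0.
have Vxu : phiv phi x u <= K1 * (phiv phi y u + `|h x| + `|h y|).
  have b'u0 : 0 <= b' * u by rewrite mulr_ge0// ltW.
  have b'u : b' * u <= c by apply: le_trans uc; rewrite ler_piMl.
  have [+ _] := Nx (b' * u) b'u0.
  move=> /(_ (le_trans (weak_Phi_nondecreasing wphi_oo point b'u0 b'u) cphi)) H1.
  have /(Ny u u0).2 H2 : (phi y u <= s%:E)%E.
    by rewrite finy// lee_fin; apply: Vs.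
  rewrite finy// in H2.
  have : (phi x (b' * (b' * u))%R <= ((phiv phi y u + h y) + h x)%:E)%E.
    by apply: le_trans H1 _; rewrite EFinD leeD2r// EFinD.
  rewrite finx ?(mulr_ge0 (ltW b'0) b'u0)// lee_fin mulrA => H3.
  have := phi_like_dec VPx bb1 (mulr_ge0 (ltW bb0) u0).
  rewrite mulrA mulVf ?gt_eqF// mul1r => /le_trans; apply.
  by rewrite ler_wpM2l//; [rewrite -/K1; lra|lra].
have Vxs := Vs x (conj VPx finx).
have K20 : 0 <= K2 by lra.
(* Where |h| exceeds 1 at one of the points, the capped error equals 1 and [V x u <= s] is
   enough. *)
have [hx1|/ltW hx1] := leP `|h x| 1; have [hy1|/ltW hy1] := leP `|h y| 1.
- apply: le_trans Vxu _; apply: ler_pM => //; lra.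
- apply: le_trans Vxs (le_trans sK2 _); rewrite ler_peMr//; lra.
- apply: le_trans Vxs (le_trans sK2 _); rewrite ler_peMr//; lra.
- apply: le_trans Vxs (le_trans sK2 _); rewrite ler_peMr//; lra.
Qed.

(* (A1) lets the null set of [y] depend on [x].  Taking for [s] the supremum of
   the inverse over the admissible points makes it independent of [x], and the
   quantifiers then need not be exchanged. *)
Lemma A1_good phi (L p q b : R) : weak_Phi phi -> 1 <= L -> 1 < p -> 0 < q ->
  0 < b -> b <= 1 -> A1 phi -> (\forall x \ae leb, good L p q b phi x) ->
  exists2 D : R, 1 <= D & forall (k N : nat), (1 <= N)%N ->
    ((N%:R)%:E * leb (rcube k) <= 1)%E ->
    exists2 s : R, 0 < s & \forall y \ae leb, rcube k y ->
      N%:R <= D * phiv phi y s /\ phiv phi y s <= D * N%:R.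
Proof.
move=> wphi L1 p1 q0 b0 b1 [b' [/andP[b'0 b'1] HA1]] Hgood.
have p0 : 0 < p by lra.
have L0 : 0 < L by lra.
have b4 : 1 <= 4 / b' by rewrite ler_pdivlMr//; lra.
have D1 : 1 <= L * (4 / b') `^ q.
  by rewrite -[leLHS]mulr1; apply: ler_pM => //; apply: powR_ge1 => //; exact: ltW.
exists (L * (4 / b') `^ q) => // k N N1 NQ; set Q := rcube k.
have N1R : 1 <= N%:R :> R by rewrite ler1n.
have Q0 : 0 < fine (leb Q) by rewrite fine_gt0// leb_rcube_gt0 leb_rcube_lty.
have QE : leb Q = (fine (leb Q))%:E by rewrite leb_rcube.
have {}NQ : N%:R * fine (leb Q) <= 1 by rewrite -lee_fin EFinM -QE.
have Q1 : (leb Q <= 1)%E.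
  by rewrite QE lee_fin; apply: le_trans NQ; rewrite ler_peMl// ltW.
pose P x := [/\ Q x, \forall y \ae leb, Q y -> b' * ginv phi x N%:R <= ginv phi y N%:R
  & good L p q b phi x].
have aeP : \forall x \ae leb, Q x -> P x.
  have H1 := HA1 Q (rcube_is_cube R n k) Q1.
  apply: filterS2 H1 Hgood => x Hx gx Qx.
  split => //; apply: filterS (Hx Qx) => y Hy Qy; apply: Hy => //.
  by rewrite N1R/= -[leRHS]mul1r ler_pdivlMr.
have N0 : 0 <= N%:R :> R by [].
(* [M] and [c] bound the inverse above and below uniformly over the admissible points, so its
   supremum is finite and positive. *)
pose M := 1 + (L / b * N%:R) `^ p^-1.
have Mge1 : 1 <= M by rewrite lerDl powR_ge0.
have Pub x : P x -> ginv phi x N%:R <= M.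
  move=> [_ _ [VP fin]]; apply: ginv_le; first by lra.
  rewrite fin; last by lra.
  rewrite lee_fin; apply: le_trans (phi_like_ge L1 VP Mge1).
  rewrite -[b / L]invf_div -ler_pdivrMl ?divr_gt0 ?invr_gt0 ?divr_gt0//.
  rewrite invrK -[leLHS](@powRK _ p) ?lt0r_neq0 ?(mulr_ge0 (divr_ge0 (ltW L0) (ltW b0)) N0)//.
  by apply: le_powR; rewrite ?(ltW p0) ?powR_ge0// lerDr.
pose c := (b / (2 * L)) `^ p^-1.
have bL : 0 < b / (2 * L) by rewrite divr_gt0//; lra.
have c0 : 0 < c by rewrite powR_gt0.
have cp : c `^ p = b / (2 * L) by rewrite powRK ?lt0r_neq0// ltW.
have c1 : c <= 1.
  apply: (le_of_powR p0) => //; first exact: ltW.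
  by rewrite cp powR1 ler_pdivrMr; lra.
have Plb x : P x -> c <= ginv phi x N%:R.
  move=> [_ _ [VP fin]]; apply: le_ginv => //; first exact: ltW.
  rewrite fin ?(ltW c0)// lte_fin.
  apply: le_lt_trans (phi_like_le L1 p1 VP (ltW c0) c1) _; rewrite cp.
  rewrite (_ : L / b * (b / (2 * L)) = 2^-1); first by lra.
  by field; rewrite !gt_eqF.
have [x1 _ Px1] := ae_exists (measurable_rcube _) (leb_rcube_gt0 R n k) aeP.
pose A := [set ginv phi z N%:R | z in P].
have supA : has_sup A.
  by split; [exists (ginv phi x1 N%:R), x1|exists M => _ [x /Pub ? <-]].
have S0 : 0 < sup A.
  apply: lt_le_trans c0 (le_trans (Plb _ Px1) _).
  by apply: sup_upper_bound => //; exists x1.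
have S20 : 0 < sup A / 2 by lra.
(* The inverse at [x0] exceeds half the supremum. By (A1) at this one point, almost every inverse on
   the cube lies between [b' * sup A / 2] and [sup A]. *)
have [_ [x0 Px0 <-] Sx0] := sup_adherent S20 supA.
exists (sup A) => //; have [_ Hx0 _] := Px0.
apply: filterS2 aeP Hx0 => y Py Hy Qy.
have [_ _ [VP fin]] := Py Qy.
have yS : ginv phi y N%:R <= sup A.
  by apply: sup_upper_bound => //; exists y => //; exact: Py.
have {}Hy := Hy Qy.
split.
- have : (N%:R%:E <= phi y (2 * sup A)%R)%E by apply: (ginv_lt wphi); lra.
  rewrite fin; last by lra.
  rewrite lee_fin => /le_trans; apply.
  apply: le_trans (phi_like_dec VP (ler1n _ 2) (ltW S0)) _.
  rewrite ler_wpM2r ?(phi_like_ge0 VP) ?(ltW S0)// ler_wpM2l ?(ltW L0)//.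
  by apply: le_powR; rewrite ?(ltW q0)// ler_pdivlMr//; lra.
- have b'S0 : 0 < b' * sup A / 4 by rewrite divr_gt0// mulr_gt0.
  have : (phi y (b' * sup A / 4)%R < N%:R%:E)%E.
    apply: lt_ginv; first exact: ltW.
    apply: lt_le_trans Hy; rewrite -mulrA ltr_pM2l//; lra.
  rewrite fin ?(ltW b'S0)// lte_fin => /ltW H.
  have := phi_like_dec VP b4 (ltW b'S0).
  rewrite (_ : 4 / b' * (b' * sup A / 4) = sup A); last by field; rewrite gt_eqF.
  by move=> /le_trans; apply; rewrite ler_wpM2l//; lra.
Qed.


End weak_Phi.

(** * The part of f above 1 *)


Section averages.
Variables (R : realType) (n : nat).
Local Notation leb := (@leb R n).
Local Notation Rn := (Rn R n).
Local Notation rcube := (@rcube R n).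
Local Notation av := (avg leb rcube).
Local Notation vol k := (fine (leb (rcube k))).
Variables (phi : Rn -> R -> \bar R) (L p q b : R).
Hypothesis wphi : weak_Phi phi.
Hypotheses (L1 : 1 <= L) (p1 : 1 < p) (q0 : 0 < q) (b0 : 0 < b) (b1 : b <= 1).
Hypothesis aegood : \forall x \ae leb, good L p q b phi x.
Local Notation V := (phiv phi).
Implicit Types (f : Rn -> R) (k : nat).

Let p0 : 0 < p. Proof. by move: p1; lra. Qed.
Let pn0 : p != 0. Proof. exact: lt0r_neq0. Qed.
Let L0 : 0 < L. Proof. by move: L1; lra. Qed.

Lemma vol_gt0 k : 0 < vol k.
Proof. by rewrite leb_rcube/= exprn_gt0// rside_gt0. Qed.

Lemma phiv_ge0 x t : 0 <= t -> 0 <= V x t.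
Proof. by move=> t0; rewrite fine_ge0// (weak_Phi_ge0 wphi). Qed.

Definition phi_root (f : Rn -> R) (y : Rn) : R := V y `|f y| `^ p^-1.

Lemma phi_root_ge0 f y : 0 <= phi_root f y. Proof. exact: powR_ge0. Qed.

Lemma phi_rootK f y : phi_root f y `^ p = V y `|f y|.
Proof. by rewrite powRK// phiv_ge0. Qed.

Lemma measurable_phi_root f :
  measurable_fun setT f -> measurable_fun setT (phi_root f).
Proof.
move=> mf; apply: (measurableT_comp (measurable_powR p^-1)).
apply: (measurableT_comp (fine_measurable measurableT)).
exact: (weak_Phi_measurable wphi).
Qed.

Lemma integral_phi_root f : measurable_fun setT f ->
  (\int[leb]_x phi x `|f x|%R <= 1)%E ->
  (\int[leb]_x (phi_root f x `^ p)%:E <= 1)%E.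
Proof.
move=> mf; apply: le_trans; apply: ge0_le_integral.
- exact: measurableT.
- by move=> x _; rewrite lee_fin powR_ge0.
- apply/measurable_EFinP; apply: (measurableT_comp (measurable_powR p)).
  exact: measurable_phi_root.
- exact: (weak_Phi_measurable wphi).
move=> x _; rewrite phi_rootK /phiv.
have := weak_Phi_ge0 wphi x (normr_ge0 (f x)).
by case: (phi x `|f x|) => [r||]//= _; rewrite leey.
Qed.

Lemma avg_phi_root f k : measurable_fun setT f ->
  (\int[leb]_x phi x `|f x|%R <= 1)%E ->
  av (phi_root f) k = (fine (av (phi_root f) k))%:E /\
  0 <= fine (av (phi_root f) k) <= 2 * (vol k)^-1 `^ p^-1.
Proof.
move=> mf If.
have := avg_le_power (@measurable_rcube R n) (@leb_rcube_gt0 R n)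
  (@leb_rcube_lty R n) k (measurable_phi_root mf) (phi_root_ge0 f) (ltW p1) ltr01
  (integral_phi_root mf If).
move=> H; have E := avg_fin_num (@leb_rcube_gt0 R n) (@leb_rcube_lty R n)
  (phi_root_ge0 f) H.
split => //; rewrite E lee_fin mul1r in H; rewrite H andbT.
apply/fine_ge0/avg_ge0; [exact: leb_rcube_gt0|exact: leb_rcube_lty|exact: phi_root_ge0].
Qed.

Definition large (f : Rn -> R) (y : Rn) : R := if 1 < `|f y| then `|f y| else 0.
Definition small (f : Rn -> R) (y : Rn) : R := if 1 < `|f y| then 0 else `|f y|.

Lemma large_ge0 f y : 0 <= large f y. Proof. by rewrite /large; case: ifP. Qed.
Lemma small_ge0 f y : 0 <= small f y. Proof. by rewrite /small; case: ifP. Qed.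
Lemma small_le1 f y : small f y <= 1.
Proof. by rewrite /small; case: ltP. Qed.
Lemma large_small f y : large f y + small f y = `|f y|.
Proof. by rewrite /large /small; case: ifP; rewrite ?addr0 ?add0r. Qed.

Lemma measurable_large f : measurable_fun setT f -> measurable_fun setT (large f).
Proof.
move=> mf; have mn : measurable_fun setT (fun x => `|f x|) by exact: measurableT_comp.
apply: (measurable_fun_ifT _ mn (measurable_cst _)).
exact: (measurable_fun_ltr (measurable_cst _) mn).
Qed.

Lemma measurable_small f : measurable_fun setT f -> measurable_fun setT (small f).
Proof.
move=> mf; have mn : measurable_fun setT (fun x => `|f x|) by exact: measurableT_comp.
apply: (measurable_fun_ifT _ (measurable_cst _) mn).
exact: (measurable_fun_ltr (measurable_cst _) mn).
Qed.

(** Let g be the average of G. If g <= 2, the growth of phi above 1 gives |f| <= [a1] G directly. If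
    g > 2, let N be the integer part of (g / 2)^p: since g <= 2 |Q|^(-1/p), N |Q| <= 1, and (A1)
    yields a threshold s common to the cube. Then the part above 1 is at most s + a G with a g <=
    [a2] s. *)
Lemma large_part : A1 phi -> exists2 C : R, 0 < C &
  forall f : Rn -> R, measurable_fun setT f ->
  (\int[leb]_x phi x `|f x|%R <= 1)%E ->
  \forall x \ae leb, forall k, rcube k x ->
  exists u : R, [/\ 0 <= u, (av (large f) k <= u%:E)%E &
    V x u <= C * fine (av (phi_root f) k) `^ p].
Proof.
move=> HA1; have [D D1 HD] := A1_good wphi L1 p1 q0 b0 b1 HA1 aegood.
have D0 : 0 < D by exact: lt_le_trans ltr01 D1.
pose a1 := (L / b) `^ p^-1.
pose a2 := 2 * (2 * L * D) `^ p^-1.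
have Lb : 1 <= L / b by rewrite ler_pdivlMr// mul1r; apply: le_trans b1 L1.
have a11 : 1 <= a1 by apply: powR_ge1 => //; rewrite invr_ge0 ltW.
have a20 : 0 <= a2 by rewrite mulr_ge0// powR_ge0.
have a2p : a2 `^ p = 2 `^ p * (2 * L * D).
  rewrite powRM ?powR_ge0// powRK//.
  by apply: mulr_ge0; [apply: mulr_ge0 => //; exact: ltW|lra].
pose C1 := L * (2 * a1) `^ q * (L / b).
pose C2 := L * (1 + a2) `^ q * D.
have C10 : 0 < C1.
  by rewrite /C1; apply: mulr_gt0; [apply: mulr_gt0 => //; apply: powR_gt0; lra|lra].
have C20 : 0 < C2.
  by rewrite /C2; apply: mulr_gt0; [apply: mulr_gt0 => //; apply: powR_gt0; lra|lra].
exists (C1 + C2); first by lra.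
move=> f mf If.
have aeN : \forall x \ae leb, forall k N : nat, (1 <= N)%N ->
    ((N%:R)%:E * leb (rcube k) <= 1)%E -> rcube k x ->
    exists s : R, [/\ 0 < s, V x s <= D * N%:R &
      \forall y \ae leb, rcube k y -> N%:R <= D * V y s].
  apply: ae_foralln => k; apply: ae_foralln => N.
  have [N1|N0] := boolP (1 <= N)%N; last by apply: aeW.
  have [NQ|NQ] := boolP ((N%:R)%:E * leb (rcube k) <= 1)%E; last by apply: aeW.
  have [s s0 Hs] := HD k N N1 NQ.
  apply: filterS (Hs) => x Hx _ _ kx; exists s; split => //; first by have [] := Hx kx.
  by apply: filterS Hs => y Hy /Hy[].
have mG := measurable_phi_root mf; have G0 := phi_root_ge0 f.
have ml := measurable_large mf; have l0 := large_ge0 f.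
have le_av := le_avg_ae (@measurable_rcube R n) (@leb_rcube_gt0 R n)
  (@leb_rcube_lty R n) ml l0 mG G0.
apply: filterS2 aegood aeN => x [VP _] HN k kx.
have [gE /andP[g0 gle]] := avg_phi_root k mf If.
set g := fine (av (phi_root f) k) in gE g0 gle *.
have vk0 := vol_gt0 k.
have gp0 := powR_ge0 g p.
have g2p : (g / 2) `^ p <= g `^ p by apply: le_powR; rewrite ?(ltW p0)//; lra.
have [g2|g2] := leP g 2.
- exists (a1 * g); split; first by rewrite mulr_ge0//; lra.
    rewrite EFinM -gE -[leRHS]add0e; apply: le_av => //; first by lra.
    apply: filterS aegood => y [VPy _] ky.
    rewrite add0r /large; case: ifPn => [/ltW f1|_]; last by rewrite mulr_ge0 ?powR_ge0.
    apply: (le_of_powR p0) => //; first by rewrite mulr_ge0 ?powR_ge0.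
    rewrite powRM ?powR_ge0// phi_rootK powRK// ?divr_ge0 ?(ltW L0) ?(ltW b0)//.
    rewrite -[L / b]invf_div ler_pdivlMl ?divr_gt0//.
    exact: (phi_like_ge L1 VPy).
  (* The argument [g / 2] is at most 1, where the upper power bound holds. *)
  have -> : a1 * g = (2 * a1) * (g / 2) by field.
  apply: (@le_trans _ _ (C1 * (g / 2) `^ p)).
    have a21 : 1 <= 2 * a1 by lra.
    have g20 : 0 <= g / 2 by lra.
    apply: le_trans (phi_like_dec VP a21 g20) _.
    rewrite /C1 -[leRHS]mulrA ler_wpM2l//.
      by apply: mulr_ge0; [exact: ltW|exact: powR_ge0].
    by apply: (phi_like_le L1 p1 VP) => //; lra.
  by apply: ler_pM => //; [lra|exact: powR_ge0|lra].
- have g21 : 1 <= g / 2 by lra.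
  have gp1 : 1 <= (g / 2) `^ p by apply: powR_ge1 => //; exact: ltW.
  have gp1' : 0 <= (g / 2) `^ p by exact: powR_ge0.
  have /andP[Ng gN] := truncn_itv gp1'.
  set N := Num.truncn ((g / 2) `^ p) in Ng gN.
  have N1 : (1 <= N)%N.
    by rewrite lt0n; apply/eqP => N0; move: gN; rewrite N0 ltNge gp1.
  have N1R : 1 <= N%:R :> R by rewrite ler1n.
  have N0 : 0 < N%:R :> R by exact: lt_le_trans ltr01 N1R.
  have gN2 : (g / 2) `^ p <= 2 * N%:R.
    by apply: le_trans (ltW gN) _; rewrite -natr1; lra.
  have NQ : ((N%:R)%:E * leb (rcube k) <= 1)%E.
    rewrite leb_rcube -EFinM lee_fin -ler_pdivlMr ?exprn_gt0 ?rside_gt0// mul1r.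
    apply: le_trans Ng _.
    have : (g / 2) `^ p <= ((vol k)^-1 `^ p^-1) `^ p.
      by apply: le_powR; rewrite ?(ltW p0)//; lra.
    by rewrite powRK ?invr_ge0 ?(ltW vk0)// leb_rcube.
  have [s [s0 Vs Hs]] := HN k N N1 NQ kx.
  have ND0 : 0 < N%:R / D by exact: divr_gt0.
  exists ((1 + a2) * s); split; first by rewrite mulr_ge0 ?(ltW s0)//; lra.
    pose a := (L / (N%:R / D)) `^ p^-1 * s.
    have a0 : 0 <= a by rewrite mulr_ge0 ?powR_ge0// ltW.
    have ag : a * g <= a2 * s.
      rewrite /a mulrAC ler_wpM2r ?(ltW s0)//.
      apply: (le_of_powR p0) => //; first by rewrite mulr_ge0 ?powR_ge0.
      have LND : 0 <= L / (N%:R / D) by rewrite divr_ge0 ?(ltW ND0) ?(ltW L0).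
      rewrite (powRM p (powR_ge0 _ _) g0) powRK// a2p.
      have gE2 : g `^ p = (2 `^ p) * (g / 2) `^ p.
        by rewrite -powRM//; [congr (_ `^ _); field|lra].
      rewrite gE2 mulrCA ler_wpM2l ?powR_ge0//.
      apply: le_trans (ler_wpM2l LND gN2) _.
      rewrite le_eqVlt; apply/orP; left; apply/eqP; field.
      by rewrite !gt_eqF.
    apply: (@le_trans _ _ (s%:E + a%:E * av (phi_root f) k)%E); last first.
      by rewrite gE -EFinM -EFinD lee_fin; lra.
    apply: le_av => //; first exact: ltW.
    apply: filterS2 aegood Hs => y [VPy _] Hy ky.
    have [ls|sl] := leP (large f y) s.
      by apply: le_trans ls _; rewrite lerDl mulr_ge0.
    apply: (@le_trans _ _ (a * phi_root f y)); last by rewrite lerDr ltW.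
    apply: (phi_like_below L1 p1 VPy s0 sl (G0 y) ND0).
      by rewrite ler_pdivrMr//; rewrite mulrC; exact: Hy.
    rewrite phi_rootK; apply: (phi_like_nd VPy) => //.
    by rewrite -[leRHS](large_small f) lerDl small_ge0.
  apply: (@le_trans _ _ (C2 * (g / 2) `^ p)).
    have a21 : 1 <= 1 + a2 by lra.
    apply: le_trans (phi_like_dec VP a21 (ltW s0)) _.
    rewrite /C2 -[leRHS]mulrA ler_wpM2l//.
      by apply: mulr_ge0; [exact: ltW|exact: powR_ge0].
    by apply: le_trans Vs _; apply: ler_wpM2l => //; lra.
  by apply: ler_pM => //; [lra|lra].
Qed.

End averages.

(** * Jensen inequality and transfer to psi *)


Section jensen.
Variables (R : realType) (n : nat).
Local Notation leb := (@leb R n).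
Local Notation Rn := (Rn R n).
Local Notation rcube := (@rcube R n).
Local Notation av := (avg leb rcube).
Local Notation vol k := (fine (leb (rcube k))).

(** With s the threshold of [V] at level e^p, the majorant is f <= s + a' E with a' e = a s, so u <=
    (1 + a) s and (aDec) absorbs 1 + a. [V] belongs to one point; all dependence on y sits in
    [E]. *)
Lemma jensen_point (L p q b : R) : 1 <= L -> 1 < p -> 0 < q -> 0 < b ->
  exists2 C : R, 0 < C & forall (V : R -> R), phi_like L p q b V ->
    forall (f E : Rn -> R) k (u e : R),
    measurable_fun setT f -> (forall y, 0 <= f y) ->
    measurable_fun setT E -> (forall y, 0 <= E y) ->
    (\forall y \ae leb, rcube k y -> V (f y) <= E y `^ p) ->
    av f k = u%:E -> 0 <= u -> (av E k <= e%:E)%E -> 0 <= e -> V u <= C * e `^ p.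
Proof.
move=> L1 p1 q0 b0; have p0 : 0 < p by lra.
have L0 : 0 < L by lra.
pose D := L * 2 `^ q.
have D0 : 0 < D by rewrite mulr_gt0// powR_gt0.
pose a := (L * D) `^ p^-1.
have a0 : 0 <= a by exact: powR_ge0.
have a1 : 1 <= 1 + a by rewrite lerDl.
have a10 : 0 < 1 + a by lra.
pose C := L * (1 + a) `^ q.
have C0 : 0 < C by rewrite mulr_gt0// powR_gt0.
exists C => // V VP f E k u e mf f0 mE E0 fE fu u0.
have main e' : 0 < e' -> (av E k <= e'%:E)%E -> V u <= C * e' `^ p.
  move=> e0 Ee; have ep0 : 0 < e' `^ p by rewrite powR_gt0.
  have [s [s0 se es]] := phi_like_threshold L1 p1 b0 VP ep0.
  have T0 : 0 < e' `^ p / D by rewrite divr_gt0.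
  pose a' := (L / (e' `^ p / D)) `^ p^-1 * s.
  have a'E : a' * e' = a * s.
    rewrite /a' mulrAC; congr (_ * _).
    rewrite (_ : L / (e' `^ p / D) = (L * D) * (e' `^ p)^-1); last first.
      by field; rewrite !gt_eqF.
    rewrite powRM ?mulr_ge0 ?invr_ge0 ?(ltW L0) ?(ltW D0) ?(ltW ep0)//.
    rewrite powRVl ?(ltW ep0)// powRVK ?lt0r_neq0 ?(ltW e0)//.
    by rewrite divfK ?gt_eqF.
  have a'0 : 0 <= a' by rewrite mulr_ge0 ?powR_ge0// ltW.
  have us : u <= (1 + a) * s.
    rewrite -lee_fin -fu.
    apply: (@le_trans _ _ (s%:E + a'%:E * av E k)%E).
      apply: le_avg_ae => //.
      - exact: measurable_rcube.
      - exact: leb_rcube_gt0.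
      - exact: leb_rcube_lty.
      - exact: ltW.
      move: fE; apply: filterS => y Hy ky.
      have [fs|sf] := leP (f y) s.
        by apply: le_trans fs _; rewrite lerDl mulr_ge0.
      apply: (@le_trans _ _ (a' * E y)); last by rewrite lerDr ltW.
      apply: (phi_like_below L1 p1 VP s0 sf (E0 y) T0 _ (Hy ky)).
      by rewrite ler_pdivrMr// mulrC.
    rewrite -lee_fin in a'0; apply: le_trans (leeD2l _ (lee_wpmul2l a'0 Ee)) _.
    by rewrite -EFinM -EFinD lee_fin a'E mulrDl mul1r.
  apply: le_trans (phi_like_nd VP u0 us) _.
  apply: le_trans (phi_like_dec VP a1 (ltW s0)) _.
  by rewrite ler_wpM2l// ltW.
move=> Ee; rewrite le_eqVlt => /predU1P[e0|e0]; last exact: main.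
(* For e = 0 there is no positive level to start from: if [V u] were positive, the level with C e'^p
   = V(u) / 2 would give a contradiction. *)
rewrite -e0 in Ee *; rewrite powR0 ?lt0r_neq0// mulr0 leNgt; apply/negP => Vu.
have VC : 0 < V u / (2 * C) by rewrite divr_gt0// mulr_gt0.
have eps0 : 0 < (V u / (2 * C)) `^ p^-1 by rewrite powR_gt0.
have := main _ eps0; rewrite powRK ?lt0r_neq0 ?(ltW VC)//.
move=> /(_ (le_trans Ee _)); rewrite lee_fin => /(_ (ltW eps0)).
rewrite (_ : C * (V u / (2 * C)) = V u / 2); last by field; rewrite gt_eqF.
by move: Vu; clear; lra.
Qed.

Variables (phi psi : Rn -> R -> \bar R) (L p q b : R).
Hypothesis wphi : weak_Phi phi.
Hypotheses (L1 : 1 <= L) (p1 : 1 < p) (q0 : 0 < q) (b0 : 0 < b) (b1 : b <= 1).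
Local Notation V := (phiv phi).

Let p0 : 0 < p. Proof. by move: p1; lra. Qed.
Let L0 : 0 < L. Proof. by move: L1; lra. Qed.

(** The level is T = V(x, u) itself: the bound by [B / m] then reads m / B <= 1 / T, which trades
    m^g for T^(-g). The case u = 0 is apart because T must be positive. *)
Lemma transfer_below (x : Rn) (c g B u m X : R) : weak_Phi psi ->
  good L p q b phi x -> 0 < c -> 0 < g -> 1 <= B ->
  (forall s T : R, 0 <= s -> 0 < T -> V x s <= B * T ->
    (psi x (c * s / T `^ g)%R <= T%:E)%E) ->
  0 <= u -> 0 < m -> V x u <= X -> V x u <= B / m ->
  (psi x (c / B `^ g * (m `^ g * u))%R <= X%:E)%E.
Proof.
move=> wpsi [VP _] c0 g0 B1 Hpsi u0 m0 uX um.
have B0 : 0 < B by lra.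
have VX : 0 <= X by apply: le_trans uX; exact: (phi_like_ge0 VP).
move: u0; rewrite le_eqVlt => /predU1P[<-|u0].
  by rewrite !mulr0 (weak_Phi0 wpsi).
have T0 : 0 < V x u by exact: (phi_like_gt0 L1 b0 VP).
apply: (@le_trans _ _ (V x u)%:E); last by rewrite lee_fin.
have TB : V x u <= B * V x u by rewrite ler_peMl// ltW.
apply: le_trans (Hpsi u (V x u) (ltW u0) T0 TB).
have Bg : 0 < B `^ g by rewrite powR_gt0.
have Tg : 0 < V x u `^ g by rewrite powR_gt0.
apply: (weak_Phi_nondecreasing wpsi).
  by rewrite !mulr_ge0 ?invr_ge0 ?powR_ge0 ?(ltW c0) ?(ltW u0).
rewrite (_ : c / B `^ g * (m `^ g * u) = c * u * (m `^ g / B `^ g)); last by ring.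
rewrite ler_wpM2l ?mulr_ge0 ?(ltW c0) ?(ltW u0)//.
rewrite ler_pdivrMr// mulrC ler_pdivlMr// -powRM ?(ltW m0) ?(ltW T0)//.
apply: le_powR; rewrite ?(ltW g0) ?(mulr_ge0 (ltW m0) (ltW T0))//.
by rewrite mulrC -ler_pdivlMr.
Qed.

(** Otherwise h would exceed S / |Q| almost everywhere on the cube and its integral would be at
    least [S]. This supplies the point that replaces [x] when [h x] is large. *)
Lemma exists_below_average (h : Rn -> R) (P : Rn -> Prop) (S : R) k :
  measurable_fun setT h -> (forall x, 0 <= h x) ->
  (\int[leb]_x (h x)%:E < S%:E)%E -> 0 < S -> (\forall x \ae leb, P x) ->
  exists z, [/\ rcube k z, P z & h z <= S / vol k].
Proof.
move=> mh h0 hS S0 aeP; apply: contrapT => H.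
have v0 := vol_gt0 R n k.
have vE : leb (rcube k) = (vol k)%:E by rewrite leb_rcube.
have : (S%:E <= \int[leb]_(x in rcube k) (h x)%:E)%E.
  rewrite -[S in X in (X <= _)%E](divfK (lt0r_neq0 v0)) EFinM -vE.
  rewrite -integral_cst; last exact: measurable_rcube.
  apply: ae_ge0_le_integral.
  - exact: measurable_rcube.
  - by move=> x _; rewrite lee_fin divr_ge0 ?(ltW S0) ?(ltW v0).
  - exact: measurable_cst.
  - by move=> x _; rewrite lee_fin.
  - by apply/measurable_EFinP; exact: measurable_funTS.
  move: aeP; apply: filterS => x Px kx; rewrite lee_fin leNgt; apply/negP => hx.
  by apply: H; exists x; split => //; exact: ltW.
apply/negP; rewrite -ltNge; apply: le_lt_trans hS.
apply: ge0_subset_integral.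
- exact: measurable_rcube.
- exact: measurableT.
- exact/measurable_EFinP.
- by move=> x _; rewrite lee_fin.
- exact: subsetT.
Qed.

End jensen.

(** * The part of f below 1 and the pointwise bound *)


Lemma le_sum3 (R : realType) (x y z : R) : 0 <= x -> 0 <= y -> 0 <= z ->
  [/\ x <= x + y + z, y <= x + y + z & z <= x + y + z].
Proof. by move=> *; split; lra. Qed.

Lemma le_sum4 (R : realType) (x y z : R) : 0 <= x -> 0 <= y -> 0 <= z ->
  [/\ 1 <= 1 + x + y + z, x <= 1 + x + y + z, y <= 1 + x + y + z &
       z <= 1 + x + y + z].
Proof. by move=> *; split; lra. Qed.

Section core.
Variables (R : realType) (n : nat).
Local Notation leb := (@leb R n).
Local Notation Rn := (Rn R n).
Local Notation rcube := (@rcube R n).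
Local Notation av := (avg leb rcube).
Local Notation vol k := (fine (leb (rcube k))).
Variables (phi psi : Rn -> R -> \bar R) (L p q b : R).
Hypothesis wphi : weak_Phi phi.
Hypotheses (L1 : 1 <= L) (p1 : 1 < p) (q0 : 0 < q) (b0 : 0 < b) (b1 : b <= 1).
Hypothesis aegood : \forall x \ae leb, good L p q b phi x.
Local Notation V := (phiv phi).
Implicit Types (f : Rn -> R) (k : nat).

Let p0 : 0 < p. Proof. by move: p1; lra. Qed.
Let pn0 : p != 0. Proof. exact: lt0r_neq0. Qed.
Let L0 : 0 < L. Proof. by move: L1; lra. Qed.

Lemma avg_small f k : measurable_fun setT f ->
  av (small f) k = (fine (av (small f) k))%:E /\ 0 <= fine (av (small f) k).
Proof.
move=> mf.
have B0 := @leb_rcube_gt0 R n; have Boo := @leb_rcube_lty R n.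
have H : (av (small f) k <= 1%:E)%E.
  have := @le_avg_ae _ _ _ _ _ (@measurable_rcube R n) B0 Boo (small f) (cst 0) k 1 0
    (measurable_small mf) (small_ge0 f) (measurable_cst _) (fun=> lexx 0) ler01 (lexx 0).
  rewrite mul0e adde0; apply.
  by apply: aeW => y _; rewrite mul0r addr0 small_le1.
split; first exact: (avg_fin_num B0 Boo (small_ge0 f) H).
exact/fine_ge0/(avg_ge0 B0)/small_ge0.
Qed.

(** The comparison of points bounds V(z, |f(y)|) by V(y, |f(y)|), h(z) and h(y). Superadditivity of
    the power p collects the three into a single E(y)^p, to which [jensen_point] at [z] applies. *)
Lemma small_part (h : Rn -> R) (D : R) : measurable_fun setT h ->
  (forall x, 0 <= h x) -> 0 < D ->
  exists2 C : R, 0 < C & forall N : set Rn, (\forall x \ae leb, N x) ->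
    (forall x y, N x -> N y -> good L p q b phi x -> good L p q b phi y ->
      forall t, 0 <= t -> t <= 1 -> V x t <= D * (V y t + h x + h y)) ->
    forall f, measurable_fun setT f -> (\int[leb]_x phi x `|f x|%R <= 1)%E ->
    forall z, N z -> good L p q b phi z -> forall k (w : R),
    av (fun y => h y `^ p^-1) k = w%:E -> 0 <= w ->
    V z (fine (av (small f) k)) <=
      C * (fine (av (phi_root phi p f) k) `^ p + h z + w `^ p).
Proof.
move=> mh h0 D0; have [C C0 HC] := @jensen_point R n L p q b L1 p1 q0 b0.
exists (C * (D * 3 `^ p)); first by rewrite !mulr_gt0// powR_gt0.
move=> N aeN HN f mf If z Nz gz k w hw w0.
have [gE /andP[g0 _]] := avg_phi_root wphi p1 k mf If.
set g := fine (av (phi_root phi p f) k) in gE g0 *.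
have [uE u0] := avg_small k mf.
pose D' := D `^ p^-1.
have D'0 : 0 <= D' by exact: powR_ge0.
pose hz := h z `^ p^-1; have hz0 : 0 <= hz by exact: powR_ge0.
pose F y := phi_root phi p f y + h y `^ p^-1.
have mhr : measurable_fun setT (fun y => h y `^ p^-1).
  exact: (measurableT_comp (measurable_powR p^-1)).
have mG := measurable_phi_root p wphi mf.
have mF : measurable_fun setT F by exact: measurable_funD mG mhr.
have F0 y : 0 <= F y by rewrite addr_ge0 ?phi_root_ge0 ?powR_ge0.
pose E y := D' * hz + D' * F y.
have mE : measurable_fun setT E.
  exact: (measurable_funD (measurable_cst _) (measurable_funM (measurable_cst _) mF)).
have E0 y : 0 <= E y by rewrite addr_ge0 ?mulr_ge0.
have Dp : D' `^ p = D by rewrite powRK// ltW.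
have B0 := @leb_rcube_gt0 R n; have Boo := @leb_rcube_lty R n.
have e0 : 0 <= D' * (g + hz + w) by rewrite mulr_ge0// !addr_ge0.
have Ee : (av E k <= (D' * (g + hz + w))%:E)%E.
  apply: (@le_trans _ _ ((D' * hz)%:E + D'%:E * av F k)%E).
    apply: (le_avg_ae (@measurable_rcube R n) B0 Boo mE E0 mF F0 (mulr_ge0 D'0 hz0) D'0).
    exact: aeW.
  rewrite /F avgD; [|exact: measurable_rcube|exact: mG|exact: phi_root_ge0|exact: mhr|
    by move=> y; exact: powR_ge0].
  apply: (@le_trans _ _ (D' * hz + D' * (g + w))%:E); first by rewrite hw gE.
  by rewrite lee_fin -mulrDr ler_wpM2l// addrA [hz + g]addrC.
have key : \forall y \ae leb, rcube k y -> V z (small f y) <= E y `^ p.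
  apply: filterS2 aegood aeN => y gy Ny _.
  apply: le_trans (HN z y Nz Ny gz gy _ (small_ge0 f y) (small_le1 f y)) _.
  rewrite /E -mulrDr (powRM p D'0 (addr_ge0 hz0 (F0 y))) Dp ler_wpM2l ?(ltW D0)// /F.
  have hh0 := powR_ge0 (h y) p^-1; have G0 := phi_root_ge0 phi p f y.
  apply: (@le_trans _ _ (hz `^ p + (phi_root phi p f y + h y `^ p^-1) `^ p)); last first.
    by apply: powRD_superadditive => //; [exact: ltW|exact: addr_ge0].
  rewrite /hz powRK// addrAC [leRHS]addrC lerD2r.
  apply: (@le_trans _ _ (phi_root phi p f y `^ p + (h y `^ p^-1) `^ p)); last first.
    by apply: powRD_superadditive => //; exact: ltW.
  rewrite powRK// lerD2r phi_rootK//.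
  apply: (phi_like_nd gy.1); first exact: small_ge0.
  by rewrite -[leRHS](large_small f) lerDr large_ge0.
have := HC _ gz.1 _ _ k _ _ (measurable_small mf) (small_ge0 f) mE E0 key uE u0 Ee e0.
move=> /le_trans; apply.
rewrite (powRM p D'0 (addr_ge0 (addr_ge0 g0 hz0) w0)) Dp -!mulrA.
rewrite ler_wpM2l ?(ltW C0)// ler_wpM2l ?(ltW D0)//.
apply: le_trans (powRD3_le (ltW p0) g0 hz0 w0) _.
by rewrite /hz powRK.
Qed.

Lemma phi_like_scale (V0 : R -> R) (u r g B : R) : phi_like L p q b V0 ->
  0 <= u -> 1 <= r -> 0 <= g -> g * q <= 1 -> V0 u <= B ->
  V0 (r `^ g * u) <= L * B * r.
Proof.
move=> VP u0 r1 g0 gq uB.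
have rg : 1 <= r `^ g by exact: powR_ge1.
apply: le_trans (phi_like_dec VP rg u0) _.
have V0u := phi_like_ge0 VP u0.
rewrite -powRrM -!mulrA ler_wpM2l ?(ltW L0)// mulrC.
apply: ler_pM; rewrite ?powR_ge0//.
by apply: le_trans (ler_powR r1 gq) _; rewrite powRr1//; lra.
Qed.

(** Bounding the two averages by maximal functions turns this into the T of the overview. *)
Definition control f (h : Rn -> R) (x : Rn) k : R :=
  fine (av (phi_root phi p f) k) `^ p + h x +
  fine (av (fun y => h y `^ p^-1) k) `^ p.

(* [z] replaces [x]: the level [B2 / m] of [u] at [z] is raised to the level
   [h x >= 1 / m] by scaling [u] with [(h x * m)^g], and (A2) carries the result
   back to [x]. *)
Lemma transfer_above (h : Rn -> R) (x z : Rn) (c g B B2 D S u m : R) :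
  weak_Phi psi -> good L p q b phi x -> good L p q b phi z ->
  0 < c -> 0 < g -> g * q <= 1 -> 1 <= B -> 0 <= B2 -> 0 <= D -> 0 <= S ->
  D * (L * B2 + 1 + S) <= B ->
  (forall s T : R, 0 <= s -> 0 < T -> V x s <= B * T ->
    (psi x (c * s / T `^ g)%R <= T%:E)%E) ->
  (forall t, 0 <= t -> t <= 1 + (L / b * (L * B2)) `^ p^-1 ->
    V x t <= D * (V z t + h x + h z)) ->
  0 <= u -> 0 < m -> m^-1 <= h x -> h x <= 1 -> h z <= S / m -> V z u <= B2 / m ->
  (psi x (c / B `^ g * (m `^ g * u))%R <= (h x)%:E)%E.
Proof.
move=> wpsi gx gz c0 g0 gq B1 B20 D0 S0 DB Hpsi HD u0 m0 mT T1 hz Vu.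
set T := h x in mT T1 HD *.
have T0 : 0 < T by apply: lt_le_trans mT; rewrite invr_gt0.
have r1 : 1 <= T * m by rewrite -ler_pdivrMr// mul1r.
pose s := (T * m) `^ g * u.
have s0 : 0 <= s by rewrite mulr_ge0 ?powR_ge0.
have Vs : V z s <= L * B2 * T.
  apply: le_trans (phi_like_scale gz.1 u0 r1 (ltW g0) gq Vu) _.
  rewrite le_eqVlt; apply/orP; left; apply/eqP; field.
  exact: lt0r_neq0.
have LB2 : 0 <= L * B2 by rewrite mulr_ge0// ltW.
have Vs1 : V z s <= L * B2 by apply: le_trans Vs _; rewrite ler_piMr.
have st := phi_like_ge_inv L1 p1 b0 gz.1 s0 LB2 Vs1.
have Vx : V x s <= B * T.
  apply: le_trans (HD s s0 st) _.
  apply: (@le_trans _ _ (D * (L * B2 + 1 + S) * T)); last by rewrite ler_wpM2r// ltW.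
  rewrite -[leRHS]mulrA ler_wpM2l// !mulrDl mul1r; apply: lerD; first exact: lerD.
  by apply: le_trans hz _; rewrite ler_wpM2l.
apply: le_trans (Hpsi s T s0 T0 Vx).
have Tg : 0 < T `^ g by rewrite powR_gt0.
apply: (weak_Phi_nondecreasing wpsi).
  by rewrite !mulr_ge0 ?invr_ge0 ?powR_ge0 ?(ltW c0).
rewrite /s (powRM g (ltW T0) (ltW m0)).
rewrite (_ : c * (T `^ g * m `^ g * u) / T `^ g = c * (m `^ g * u)); last first.
  by field; exact: lt0r_neq0.
rewrite ler_wpM2r ?mulr_ge0 ?powR_ge0// ler_pdivrMr ?ler_peMr ?(ltW c0)//.
  by apply: powR_ge1 => //; exact: ltW.
by apply: powR_gt0; exact: lt_le_trans ltr01 B1.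
Qed.

Lemma frac_termE (g : R) f k (u1 u2 : R) : measurable_fun setT f ->
  (av (large f) k <= u1%:E)%E -> (av (small f) k <= u2%:E)%E ->
  frac_term g f k \is a fin_num /\
  0 <= fine (frac_term g f k) <= vol k `^ g * (u1 + u2).
Proof.
move=> mf au1 au2; have m0 := vol_gt0 R n k.
have E : frac_term g f k = ((vol k `^ g)%:E * (av (large f) k + av (small f) k))%E.
  rewrite -(avgD leb (@measurable_rcube R n) k (measurable_large mf) (large_ge0 f)
    (measurable_small mf) (small_ge0 f)).
  rewrite /avg muleA -EFinM /frac_term; congr (_%:E * _)%E; last first.
    by apply: eq_integral => y _; rewrite large_small.
  rewrite powRB; last by rewrite (gt_eqF m0) implybT.
  by rewrite (powRr1 (ltW m0)) invf_div.
have f0 : (0 <= frac_term g f k)%E by exact: frac_term_ge0.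
have fu : (frac_term g f k <= (vol k `^ g * (u1 + u2))%:E)%E.
  rewrite E EFinM; apply: lee_wpmul2l; first by rewrite lee_fin powR_ge0.
  by rewrite EFinD; exact: leeD.
have ff : frac_term g f k \is a fin_num.
  by rewrite ge0_fin_numE// (le_lt_trans fu)// ltry.
by split => //; rewrite -!lee_fin fineK// f0.
Qed.

Lemma avg_root (h : Rn -> R) (S : R) k : measurable_fun setT h ->
  (forall x, 0 <= h x) -> 0 < S -> (\int[leb]_x (h x)%:E <= S%:E)%E ->
  exists w : R, [/\ av (fun y => h y `^ p^-1) k = w%:E, 0 <= w &
    w `^ p <= 2 `^ p * S / vol k].
Proof.
move=> mh h0 S0 hS; have m0 := vol_gt0 R n k.
have mhr : measurable_fun setT (fun y => h y `^ p^-1).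
  exact: (measurableT_comp (measurable_powR p^-1)).
have hr0 y : 0 <= h y `^ p^-1 by exact: powR_ge0.
have B0 := @leb_rcube_gt0 R n; have Boo := @leb_rcube_lty R n.
have hp : (\int[leb]_x ((h x `^ p^-1) `^ p)%:E <= S%:E)%E.
  by apply: le_trans hS; under eq_integral do rewrite powRK//.
have H := avg_le_power (@measurable_rcube R n) B0 Boo k mhr hr0 (ltW p1) S0 hp.
have E := avg_fin_num B0 Boo hr0 H.
have w0 := fine_ge0 (avg_ge0 B0 Boo k hr0).
exists (fine (av (fun y => h y `^ p^-1) k)); split => //.
have Sm : 0 <= S / vol k by rewrite divr_ge0// ltW.
rewrite E lee_fin in H; apply: le_trans (le_powR (ltW p0) w0 H) _.
by rewrite powRM ?powR_ge0// powRK// mulrA.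
Qed.

(** [B2] bounds the small part at points with small [h]; it fixes how far the second use of (A2)
    must reach, hence [D'], and [B] dominates all ratios. The parts above and below 1 are
    transferred separately and recombined by u1 + u2 <= 2 max(u1, u2), whence the last factor 1/2 in
    the witness. *)
Lemma frac_bound (g : R) : weak_Phi psi -> inv_equiv g phi psi ->
  0 < g -> g * q <= 1 -> A1 phi -> A2 phi ->
  exists h : Rn -> R, [/\ measurable_fun setT h, (forall x, 0 <= h x <= 1),
    (\int[leb]_x (h x)%:E < +oo)%E &
  exists C c : R, [/\ 0 < C, 0 < c &
  forall f, measurable_fun setT f -> (\int[leb]_x phi x `|f x|%R <= 1)%E ->
  \forall x \ae leb, forall k, rcube k x ->
    frac_term g f k \is a fin_num /\
    (psi x (c * fine (frac_term g f k))%R <= (C * control f h x k)%:E)%E]].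
Proof.
move=> wpsi Heq g0 gq HA1 HA2.
have [h [mh h01 hoo Hh]] := A2_good wphi L1 p1 q0 b0 HA2.
have h0 x : 0 <= h x by have /andP[] := h01 x.
have h1 x : h x <= 1 by have /andP[] := h01 x.
have Ih0 : (0 <= \int[leb]_x (h x)%:E)%E by apply: integral_ge0 => x _; rewrite lee_fin.
pose S := fine (\int[leb]_x (h x)%:E) + 1.
have S0 : 0 < S by rewrite ltr_pwDr// fine_ge0.
have IS : (\int[leb]_x (h x)%:E < S%:E)%E.
  by rewrite -(@fineK _ (\int[leb]_x (h x)%:E)%E) ?ge0_fin_numE// lte_fin ltrDl.
have [C1 C10 HC1] := large_part wphi L1 p1 q0 b0 b1 aegood HA1.
have [D D1 [N1 aeN1 HN1]] := Hh 1.
have [Cs Cs0 HCs] := small_part mh h0 (lt_le_trans ltr01 D1).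
have tp0 : 0 < 2 `^ p :> R by exact: powR_gt0.
(* The summands bound |Q| times the three terms of the estimate; [S + 1] covers both h <= 1 / |Q| at
   [x] and h <= S / |Q| at [z]. *)
pose K := 2 `^ p + (S + 1) + 2 `^ p * S.
have K0 : 0 < K := addr_gt0 (addr_gt0 tp0 (addr_gt0 S0 ltr01)) (mulr_gt0 tp0 S0).
pose B2 := Cs * K.
have B20 : 0 < B2 := mulr_gt0 Cs0 K0.
have [D' D'1 [N2 aeN2 HN2]] := Hh (1 + (L / b * (L * B2)) `^ p^-1).
have D'0 : 0 < D' by exact: lt_le_trans ltr01 D'1.
pose B3 := D' * (L * B2 + 1 + S).
have B30 : 0 < B3 :=
  mulr_gt0 D'0 (addr_gt0 (addr_gt0 (mulr_gt0 L0 B20) ltr01) S0).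
pose B := 1 + C1 * 2 `^ p + B2 + B3.
have C12 : 0 < C1 * 2 `^ p := mulr_gt0 C10 tp0.
have [B1 B1' B2B B3B] : [/\ 1 <= B, C1 * 2 `^ p <= B, B2 <= B & B3 <= B].
  exact: le_sum4 (ltW C12) (ltW B20) (ltW B30).
clearbody B; have B0 : 0 < B by exact: lt_le_trans ltr01 B1.
have [c c0 Hc] := psi_transfer q b wphi wpsi L1 p1 Heq B1.
exists h; split => //; exists (C1 + Cs + 1), (c / B `^ g / 2).
have Bg : 0 < B `^ g by rewrite powR_gt0.
have cB0 : 0 < c / B `^ g by rewrite divr_gt0.
have [CC1 CCs C1C] := le_sum3 (ltW C10) (ltW Cs0) (@ler01 R).
set C := C1 + Cs + 1 in CC1 CCs C1C *.
split; [exact: lt_le_trans ltr01 C1C|by rewrite divr_gt0|].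
move=> f mf If.
have aeN : \forall x \ae leb, [/\ N1 x, N2 x & good L p q b phi x].
  by apply: filterS3 aeN1 aeN2 aegood.
apply: filterS3 (aeN) (HC1 f mf If) Hc => x [N1x N2x gx] Hx Hcx k kx.
have {}Hcx := Hcx gx.
have m0 := vol_gt0 R n k.
have [gE /andP[G0 G2]] := avg_phi_root wphi p1 k mf If.
have [w [wE w0 wS]] := avg_root k mh h0 S0 (ltW IS).
have [u2E u20] := avg_small k mf.
have [u1 [u10 au1 Vu1]] := Hx k kx.
have Vz := HCs N1 aeN1 HN1 f mf If.
have u2le : (av (small f) k <= (fine (av (small f) k))%:E)%E by rewrite -u2E.
have [frfin /andP[fr0 fr]] := frac_termE g mf au1 u2le.
have {}Vz z : N1 z -> good L p q b phi z -> V z (fine (av (small f) k)) <=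
    Cs * (fine (av (phi_root phi p f) k) `^ p + h z + w `^ p).
  by move=> N1z gz; exact: Vz.
have -> : control f h x k = fine (av (phi_root phi p f) k) `^ p + h x + w `^ p.
  by rewrite /control wE.
set G := fine (av (phi_root phi p f) k) in G0 G2 Vu1 Vz *.
set u2 := fine (av (small f) k) in u20 fr Vz.
set m := vol k in m0 G2 wS fr.
have Gp : G `^ p <= 2 `^ p / m.
  apply: le_trans (le_powR (ltW p0) G0 G2) _.
  by rewrite powRM ?powR_ge0// powRK// invr_ge0 ltW.
have Gp0 := powR_ge0 G p; have wp0 := powR_ge0 w p.
set W := G `^ p + h x + w `^ p.
have GW : G `^ p <= W by rewrite /W -addrA lerDl addr_ge0.
have hW : h x <= W by rewrite /W addrAC lerDr addr_ge0.
have W0 : 0 <= W by exact: le_trans Gp0 GW.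
have im0 : 0 < m^-1 by rewrite invr_gt0.
have Vm z : N1 z -> good L p q b phi z -> h z <= (S + 1) / m -> V z u2 <= B2 / m.
  move=> N1z gz hz; apply: le_trans (Vz z N1z gz) _.
  rewrite /B2 -mulrA ler_wpM2l ?(ltW Cs0)//.
  by rewrite /K [leRHS]mulrDl [X in _ <= X + _]mulrDl; exact: lerD (lerD Gp hz) wS.
have H1 : (psi x (c / B `^ g * (m `^ g * u1))%R <= (C * W)%:E)%E.
  apply: (transfer_below L1 b0 wpsi gx c0 g0 B1 Hcx u10 m0).
    by apply: le_trans Vu1 _; apply: ler_pM => //; exact: ltW.
  apply: le_trans Vu1 _; apply: (@le_trans _ _ (C1 * (2 `^ p / m))).
    by rewrite ler_wpM2l// ltW.
  by rewrite mulrA ler_wpM2r// ltW.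
have H2 : (psi x (c / B `^ g * (m `^ g * u2))%R <= (C * W)%:E)%E.
  have [hm|/ltW hm] := leP (h x) m^-1.
    apply: (transfer_below L1 b0 wpsi gx c0 g0 B1 Hcx u20 m0).
      by apply: le_trans (Vz x N1x gx) _; rewrite ler_wpM2r.
    apply: (@le_trans _ _ (B2 / m)); last by rewrite ler_wpM2r// ltW.
    apply: Vm => //; apply: le_trans hm _.
    by rewrite ler_peMl ?(ltW im0)// lerDr ltW.
  have [z [kz [N1z N2z gz] hz]] := exists_below_average k mh h0 IS S0 aeN.
  apply: (@le_trans _ _ (h x)%:E); last first.
    by rewrite lee_fin (le_trans hW)// ler_peMl.
  apply: (transfer_above wpsi gx gz c0 g0 gq B1 (ltW B20) (ltW D'0) (ltW S0) B3B Hcx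
    _ u20 m0 hm (h1 x) hz).
    by move=> t t0 tt; exact: HN2.
  apply: Vm => //; apply: le_trans hz _.
  by rewrite ler_wpM2r ?(ltW im0)// lerDl.
split => //.
have mg0 : 0 <= m `^ g by exact: powR_ge0.
have arg0 : 0 <= c / B `^ g / 2 * fine (frac_term g f k).
  by rewrite mulr_ge0// divr_ge0// ltW.
have key u : u1 + u2 <= 2 * u ->
    c / B `^ g / 2 * fine (frac_term g f k) <= c / B `^ g * (m `^ g * u).
  move=> uu; rewrite -mulrA ler_wpM2l ?(ltW cB0)//.
  rewrite ler_pdivrMl//; apply: le_trans fr _.
  by rewrite mulrCA ler_wpM2l.
have [u12|/ltW u21] := leP u1 u2.
- apply: le_trans H2; apply: (weak_Phi_nondecreasing wpsi) => //.
  by apply: key; rewrite mulr_natl mulr2n lerD2r.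
- apply: le_trans H1; apply: (weak_Phi_nondecreasing wpsi) => //.
  by apply: key; rewrite mulr_natl mulr2n lerD2l.
Qed.

End core.

(** * Boundedness of the fractional maximal operator *)


Section boundedness.
Variables (R : realType) (n : nat).
Local Notation leb := (@leb R n).
Local Notation Rn := (Rn R n).
Local Notation rcube := (@rcube R n).
Local Notation av := (avg leb rcube).
Local Notation maxf := (maxf leb rcube).
Implicit Types (phi psi : Rn -> R -> \bar R) (f : Rn -> R).

(** This replaces convexity: shrinking the argument shrinks the modular at least linearly up to [L],
    so any finite modular can be brought below 1. *)
Lemma weak_Phi_scale phi : weak_Phi phi -> exists2 L : R, 1 <= L &
  forall x (a t : R), 0 < a -> a <= 1 -> 0 <= t ->
    (phi x (a * t)%R <= (L * a)%:E * phi x t)%E.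
Proof.
move=> wphi; have [L [L1 HL]] := weak_Phi_aInc1 wphi; exists L => //.
move=> x a t a0; have L0 : 0 < L by lra.
rewrite le_eqVlt => /predU1P[-> t0|a1].
  rewrite mul1r mulr1 -[leLHS]mul1e; apply: lee_wpmul2r; last by rewrite lee_fin.
  exact: (weak_Phi_ge0 wphi).
rewrite le_eqVlt => /predU1P[<-|t0].
  by rewrite mulr0 (weak_Phi0 wphi) mule0.
have at0 : 0 < a * t by rewrite mulr_gt0.
have := HL x (a * t) t at0; rewrite gtr_pMl// => /(_ a1) H.
rewrite -(@lee_pmul2r _ ((a * t)^-1)%:E)//; last by rewrite lte_fin invr_gt0.
apply: le_trans H _; rewrite [(phi x t * _)%E]muleC [leRHS]muleAC !muleA -!EFinM.
by rewrite (_ : L * a / (a * t) = L / t)//; field; rewrite !gt_eqF.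
Qed.

(** [psi] need not be left-continuous, so monotonicity reaches only values strictly below the
    supremum M; halving [c] uses M / 2 < M. If M is infinite, psi tending to infinity forces [B] to
    be infinite. *)
Lemma phi_ext_sup psi x (c : R) (B : \bar R) (P : set nat) (a : nat -> \bar R) :
  weak_Phi psi -> 0 < c -> (0 <= B)%E -> (forall k, (0 <= a k)%E) ->
  (forall k, P k -> a k \is a fin_num /\ (psi x (c * fine (a k))%R <= B)%E) ->
  (phi_ext psi x `|(c / 2)%:E *
     ereal_sup (range (fun k => (\1_P k)%:E * a k))| <= B)%E.
Proof.
move=> wpsi c0 B0 a0 HB; set M := ereal_sup _.
have c20 : 0 < c / 2 by rewrite divr_gt0.
have above (r : R) : 0 <= r -> (r%:E < M)%E -> (psi x (c * r)%R <= B)%E.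
  move=> r0 /ereal_sup_gt[_ [k _ <-]]; rewrite indicE.
  have [/set_mem Pk|_] := boolP (k \in P); last by rewrite mul0e lte_fin ltNge r0.
  have [ak /(le_trans _)] := HB k Pk; rewrite mul1e => H rk; apply: H.
  apply: (weak_Phi_nondecreasing wpsi); first by rewrite mulr_ge0// ltW.
  by rewrite ler_pM2l// -lee_fin fineK// ltW.
have : (0 <= M)%E.
  apply: le_trans (ereal_sup_ubound _); last by exists 0%N.
  by rewrite mule_ge0// lee_fin.
case: M above => [r above r0|above _|//].
- rewrite -EFinM /= ger0_norm; last by rewrite mulr_ge0// ltW.
  move: r0; rewrite lee_fin le_eqVlt => /predU1P[<-|r0].
    by rewrite mulr0 (weak_Phi0 wpsi).
  rewrite -mulrA [2^-1 * r]mulrC; apply: above.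
    by rewrite divr_ge0// ltW.
  by rewrite lte_fin ltr_pdivrMr// ltr_pMr// ltr1n.
- rewrite gt0_muley ?lte_fin//= leye_eq; apply/eqP/eqyP => A A0.
  have /cvgeyPge/(_ A)[t [_ Ht]] := weak_Phi_cvgy wpsi x.
  pose s := Num.max 0 (t / c + 1).
  have s0 : 0 <= s by rewrite le_max lexx.
  apply: le_trans (above s s0 (ltry _)); apply: Ht.
  by rewrite mulrC -ltr_pdivrMr// lt_max ltrDl ltr01 orbT.
Qed.

Lemma measurable_phi_ext psi (M : Rn -> \bar R) : weak_Phi psi ->
  measurable_fun setT M -> (forall x, 0 <= M x)%E ->
  measurable_fun setT (fun x => phi_ext psi x `|M x|%E).
Proof.
move=> wpsi mM M0.
rewrite (_ : (fun _ => _) = fun x => if (M x < +oo)%E then psi x `|fine (M x)|%R else +oo%E).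
  apply: measurable_fun_ifT.
  - exact: (measurable_fun_lte mM (measurable_cst _)).
  - apply: (weak_Phi_measurable wpsi).
    exact: (measurableT_comp (fine_measurable measurableT) mM).
  - exact: measurable_cst.
by apply/funext => x; have := M0 x; case: (M x) => [r||]//= _; rewrite ltry.
Qed.

Lemma phi_ext_ge0 psi x e : weak_Phi psi -> (0 <= e)%E -> (0 <= phi_ext psi x e)%E.
Proof. by move=> wpsi; case: e => [r||]//=; rewrite lee_fin; exact: weak_Phi_ge0. Qed.

Lemma measurable_frac_maximal (alpha : R) f : (0 < n)%N -> alpha < n%:R ->
  measurable_fun setT f -> measurable_fun setT (frac_maximal alpha f).
Proof.
move=> n0 an mf.
pose u k x := ((\1_(rcube k) x)%:E * frac_term (alpha / n%:R) f k)%E.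
rewrite (_ : frac_maximal alpha f = fun x => esups (fun k => u k x) 0%N).
  apply: measurable_fun_esups => k; apply: emeasurable_funM; last exact: measurable_cst.
  by apply/measurable_EFinP; apply: measurable_indic; exact: measurable_rcube.
apply/funext => x; rewrite frac_maximalE// /esups/= /sdrop; congr ereal_sup.
by apply/seteqP; split => [_ [k _ <-]|_ [k _ <-]]; exists k.
Qed.

Lemma frac_maximal_ge0 (alpha : R) f x : (0 < n)%N -> alpha < n%:R ->
  measurable_fun setT f -> (0 <= frac_maximal alpha f x)%E.
Proof.
move=> n0 an mf; rewrite frac_maximalE//.
apply: le_trans (ereal_sup_ubound _); last by exists 0%N.
by rewrite mule_ge0 ?lee_fin//; exact: frac_term_ge0.
Qed.

Lemma frac_maximalZ (alpha a : R) f x : 0 < a -> measurable_fun setT f ->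
  frac_maximal alpha (fun y => a * f y) x = (a%:E * frac_maximal alpha f x)%E.
Proof.
have le (b : R) g : 0 < b -> measurable_fun setT g ->
    (frac_maximal alpha (fun y => (b * g y)%R) x <= b%:E * frac_maximal alpha g x)%E.
  move=> b0 mg; apply: ge_ereal_sup => _ [Q [cQ Qx ->]].
  rewrite (eq_integral (fun y => (b%:E * `|g y|%:E)%E)); last first.
    by move=> y _; rewrite normrM gtr0_norm.
  have mQ : measurable Q by case: cQ => d [l [_ ->]]; exact: measurable_cube.
  rewrite ge0_integralZl_EFin; last 4 first.
  - exact: mQ.
  - by move=> y _; rewrite lee_fin.
  - by apply/measurable_EFinP/measurable_funTS/measurableT_comp.
  - exact: ltW.
  rewrite muleCA; apply: lee_wpmul2l; first by rewrite lee_fin ltW.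
  by apply: ereal_sup_ubound; exists Q; split.
move=> a0 mf; apply/eqP; rewrite eq_le le//=.
rewrite -lee_pdivlMl//; have ai : 0 < a^-1 by rewrite invr_gt0.
have maf : measurable_fun setT (fun y => a * f y) by exact: measurable_funM.
apply: le_trans (le _ _ ai maf); rewrite le_eqVlt; apply/orP; left; apply/eqP.
congr frac_maximal; apply/funext => y; rewrite mulrA mulVf ?mul1r// gt_eqF//.
Qed.

End boundedness.


(** * The modular estimate for functions of modular at most 1 *)

Section unit_ball.
Variables (R : realType) (n : nat).
Local Notation leb := (@leb R n).
Local Notation Rn := (Rn R n).
Local Notation rcube := (@rcube R n).
Local Notation av := (avg leb rcube).
Local Notation maxf := (maxf leb rcube).
Implicit Types (phi psi : Rn -> R -> \bar R) (f : Rn -> R).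

Lemma rcube_maximal_inequality (p : R) f : 1 < p -> measurable_fun setT f ->
  (forall x, 0 <= f x) ->
  (\int[leb]_x (maxf f x `^ p) <= (maximal_cst (3 ^+ n) p)%:E * \int[leb]_x (f x `^ p)%:E)%E.
Proof.
move=> p1 mf f0.
apply: (maximal_function_Lp (@measurable_rcube R n) (@leb_rcube_gt0 R n)
  (@leb_rcube_lty R n) (@rcube_vitali R n) mf f0 _ p1).
by rewrite exprn_ge0.
Qed.

Lemma avg_powR_le_maxf (p : R) f k x : 0 <= p -> (forall y, 0 <= f y) ->
  rcube k x -> ((fine (av f k) `^ p)%:E <= maxf f x `^ p)%E.
Proof.
move=> p0 f0 kx.
have a0 : (0 <= av f k)%E by exact: (avg_ge0 (@leb_rcube_gt0 R n) (@leb_rcube_lty R n)).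
have M0 := maxf_ge0 (@leb_rcube_gt0 R n) (@leb_rcube_lty R n) x f0.
rewrite -poweR_EFin; apply: gt0_ler_poweR => //.
- by rewrite in_itv/= leey andbT lee_fin fine_ge0.
- by rewrite in_itv/= leey andbT.
apply: le_trans (avg_le_maxf leb f kx).
by case: (av f k) a0 => [s||]//= _; rewrite leey.
Qed.

Lemma frac_maximal_unit_ball (p alpha r : R) phi psi :
  1 < p -> 0 < alpha < n%:R -> weak_Phi phi -> weak_Phi psi ->
  inv_equiv (alpha / n%:R) phi psi -> alpha / n%:R < r ->
  A0 phi -> A1 phi -> A2 phi -> aInc p phi -> aDec r^-1 phi ->
  exists2 d : R, 0 < d & forall f, measurable_fun setT f ->
    (\int[leb]_x phi x `|f x|%R <= 1)%E ->
    (modular psi (fun x => d%:E * frac_maximal alpha f x) <= 1)%E.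
Proof.
move=> p1 /andP[a0 an] wphi wpsi Heq ar HA0 HA1 HA2 Hinc Hdec.
have p0 : 0 < p by lra.
have n0R : 0 < n%:R :> R by lra.
have n0 : (0 < n)%N by rewrite -(ltr0n R).
set g := alpha / n%:R in Heq ar.
have g0 : 0 < g by rewrite divr_gt0.
have r0 : 0 < r by lra.
have q0 : 0 < r^-1 by rewrite invr_gt0.
(* The lower bound on [r] enters here: raising a level by a factor costs its power g / r, at most
   the factor itself. *)
have gq : g * r^-1 <= 1 by rewrite ler_pdivrMr// mul1r ltW.
have [L [b [L1 b0 b1 aegood]]] := ae_good wphi p0 q0 HA0 Hinc Hdec.
have [h [mh h01 hoo [C [c [C0 c0 HC]]]]] :=
  frac_bound wphi L1 p1 q0 b0 b1 aegood wpsi Heq g0 gq HA1 HA2.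
have [Lp Lp1 HLp] := weak_Phi_scale wpsi.
have h0 x : 0 <= h x by have /andP[] := h01 x.
have Ih0 : (0 <= \int[leb]_x (h x)%:E)%E by apply: integral_ge0 => x _; rewrite lee_fin.
have IhE : (\int[leb]_x (h x)%:E = (fine (\int[leb]_x (h x)%:E))%:E)%E.
  by rewrite fineK// ge0_fin_numE.
set S := fine _ in IhE.
have S0 : 0 <= S by rewrite fine_ge0.
pose A := maximal_cst (3 ^+ n) p.
have A0' : 0 <= A by apply: maximal_cst_ge0 => //; rewrite exprn_ge0.
pose K := A + S + A * S.
have K0 : 0 <= K by rewrite !addr_ge0// mulr_ge0.
have Lp0 : 0 < Lp by exact: lt_le_trans ltr01 Lp1.
have LCK : 0 <= Lp * C * K by rewrite !mulr_ge0// ltW.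
have LCK1 : 0 < 1 + Lp * C * K by rewrite ltr_wpDr.
(* Without [l] the modular would be bounded only by [Lp * C * K]; shrinking the argument by [l]
   brings this below 1. *)
pose l := (1 + Lp * C * K)^-1.
have l0 : 0 < l by rewrite invr_gt0.
have l1 : l <= 1 by rewrite invf_le1// lerDl.
have lc0 : 0 < l * c by rewrite mulr_gt0.
have LlC : 0 <= Lp * l * C by rewrite !mulr_ge0// ltW.
exists (l * c / 2); first by rewrite divr_gt0.
move=> f mf If.
pose G := phi_root phi p f; pose H y := h y `^ p^-1.
have mG : measurable_fun setT G by exact: measurable_phi_root.
have mH : measurable_fun setT H by exact: (measurableT_comp (measurable_powR p^-1)).
have G0 y : 0 <= G y by exact: powR_ge0.
have H0 y : 0 <= H y by exact: powR_ge0.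
have mMp (F : Rn -> R) : measurable_fun setT (fun x => (maxf F x `^ p)%E).
  exact: (measurableT_comp (measurable_poweR p) (measurable_maxf leb (@measurable_rcube R n) F)).
pose T x := (maxf G x `^ p + (h x)%:E + maxf H x `^ p)%E.
have mEh : measurable_fun setT (EFin \o h) by exact/measurable_EFinP.
have mT1 : measurable_fun setT (fun x => maxf G x `^ p + (h x)%:E)%E.
  exact: emeasurable_funD.
have mT : measurable_fun setT T by exact: emeasurable_funD.
have T10 x : (0 <= maxf G x `^ p + (h x)%:E)%E.
  by rewrite adde_ge0 ?poweR_ge0 ?lee_fin.
have T0 x : (0 <= T x)%E by rewrite adde_ge0 ?poweR_ge0.
have IT : (\int[leb]_x T x <= K%:E)%E.
  rewrite ge0_integralD//; last by move=> x _; exact: poweR_ge0.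
  rewrite ge0_integralD//; last 2 first.
  - by move=> x _; exact: poweR_ge0.
  - by move=> x _; rewrite lee_fin.
  rewrite /K !EFinD; apply: leeD; first apply: leeD.
  - apply: le_trans (rcube_maximal_inequality p1 mG G0) _.
    rewrite -[leRHS]mule1; apply: lee_wpmul2l; first by rewrite lee_fin.
    exact: integral_phi_root.
  - by rewrite IhE.
  - apply: le_trans (rcube_maximal_inequality p1 mH H0) _.
    rewrite [leRHS]EFinM; apply: lee_wpmul2l; first by rewrite lee_fin.
    rewrite -IhE le_eqVlt; apply/orP; left; apply/eqP.
    by apply: eq_integral => x _; rewrite powRK ?lt0r_neq0.
have M0 x : (0 <= (l * c / 2)%:E * frac_maximal alpha f x)%E.
  by rewrite mule_ge0 ?frac_maximal_ge0// lee_fin divr_ge0// ltW.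
have mM := measurable_frac_maximal n0 an mf.
have mdM : measurable_fun setT (fun x => (l * c / 2)%:E * frac_maximal alpha f x)%E.
  exact: (emeasurable_funM (measurable_cst _) mM).
apply: (@le_trans _ _ (\int[leb]_x ((Lp * l * C)%:E * T x))%E); last first.
  rewrite ge0_integralZl_EFin//.
  apply: (@le_trans _ _ ((Lp * l * C)%:E * K%:E)%E).
    by apply: lee_wpmul2l; rewrite ?lee_fin.
  rewrite -EFinM lee_fin (_ : Lp * l * C * K = (Lp * C * K) * l); last by ring.
  by rewrite ler_pdivrMr// mul1r lerDr.
apply: ae_ge0_le_integral.
- exact: measurableT.
- by move=> x _; exact: phi_ext_ge0 wpsi (abse_ge0 _).
- exact: (measurable_phi_ext wpsi mdM M0).
- by move=> x _; rewrite mule_ge0 ?lee_fin.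
- exact: (emeasurable_funM (measurable_cst _) mT).
apply: filterS (HC f mf If) => x Hx _.
rewrite frac_maximalE// -/g.
rewrite (_ : (fun k => _) =
    fun k => ((\1_[set k | rcube k x] k)%:E * frac_term g f k)%E); last first.
  by apply/funext => k; rewrite !indicE; congr (_%:R%:E * _)%E.
apply: (phi_ext_sup wpsi lc0).
- by rewrite mule_ge0 ?lee_fin.
- by move=> k; exact: frac_term_ge0.
move=> k /= kx; have [fk fkle] := Hx k kx; split => //.
have fk0 : 0 <= fine (frac_term g f k) by rewrite fine_ge0// frac_term_ge0.
rewrite -[l * c * _]mulrA; apply: le_trans (HLp x l _ l0 l1 (mulr_ge0 (ltW c0) fk0)) _.
have Ll : (0 <= (Lp * l)%:E)%E by rewrite lee_fin mulr_ge0// ltW.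
apply: le_trans (lee_wpmul2l Ll fkle) _.
rewrite -EFinM mulrA EFinM; apply: lee_wpmul2l; first by rewrite lee_fin.
rewrite /control !EFinD; apply: leeD; first apply: leeD => //.
- exact: (avg_powR_le_maxf (ltW p0) G0 kx).
- exact: (avg_powR_le_maxf (ltW p0) H0 kx).
Qed.

End unit_ball.

Unset Implicit Arguments.

Theorem theorem3p3 (R : realType) (n : nat) (p q alpha r : R)
    (phi psi : Rn R n -> R -> \bar R) :
  1 < p -> p <= q ->
  0 < alpha < n%:R ->
  alpha / n%:R = p^-1 - q^-1 ->
  weak_Phi phi -> weak_Phi psi ->
  inv_equiv (alpha / n%:R) phi psi ->
  alpha / n%:R < r <= p^-1 ->
  A0 phi -> A1 phi -> A2 phi -> aInc p phi -> aDec r^-1 phi ->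
  exists C : R, 0 < C /\
    forall f : Rn R n -> R, Lphi phi (EFin \o f) ->
      Lphi psi (frac_maximal alpha f) /\
      (Lphi_norm psi (frac_maximal alpha f)
         <= C%:E * Lphi_norm phi (EFin \o f))%E.
Proof.
move=> p1 _ /[dup] alpha_n /andP[a0 an] _ wphi wpsi Heq /andP[ar _] HA0 HA1 HA2 Hinc Hdec.
have n0 : (0 < n)%N by rewrite -(ltr0n R); lra.
have [d d0 Hd] := frac_maximal_unit_ball p1 alpha_n wphi wpsi Heq ar HA0 HA1 HA2 Hinc Hdec.
have [L L1 HL] := weak_Phi_scale wphi.
exists d^-1; split; first by rewrite invr_gt0.
move=> f [/measurable_EFinP mf [l [l0 hl]]].
have L0 : 0 < L by lra.
have mM := measurable_frac_maximal n0 an mf.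
(* Homogeneity of the maximal operator extends the unit-ball estimate to every multiple of [f] with
   modular at most 1. *)
have key (a : R) : 0 < a -> (modular phi (fun x => a%:E * (f x)%:E) <= 1)%E ->
    (modular psi (fun x => (d * a)%:E * frac_maximal alpha f x) <= 1)%E.
  move=> a_gt0 ha; have maf : measurable_fun setT (fun x => a * f x).
    exact: (measurable_funM (measurable_cst _) mf).
  have := Hd _ maf ha.
  rewrite (_ : (fun x => _) = (fun x => (d * a)%:E * frac_maximal alpha f x)%E)//.
  by apply/funext => x; rewrite frac_maximalZ// muleA -EFinM.
split.
  split => //.
  set I := modular phi _ in hl.
  have I0 : (0 <= I)%E by apply: integral_ge0 => x _; exact: phi_ext_ge0 wphi (abse_ge0 _).
  have IE : I = (fine I)%:E by rewrite fineK// ge0_fin_numE.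
  have fI0 : 0 <= fine I by rewrite fine_ge0.
  have LI : 0 < 1 + L * fine I by rewrite ltr_wpDr// mulr_ge0// ltW.
  have LI1 : (1 + L * fine I)^-1 <= 1 by rewrite invf_le1// lerDl mulr_ge0// ltW.
  have LI0 : 0 < (1 + L * fine I)^-1 by rewrite invr_gt0.
  (* Membership gives only a finite modular [I] of l f; the factor [e] makes the modular of e l f at
     most 1. *)
  set e := (1 + L * fine I)^-1 in LI1 LI0.
  have el0 : 0 < e * l by rewrite mulr_gt0.
  exists (d * (e * l)); split; first by rewrite mulr_gt0.
  apply: le_lt_trans (ltry 1); apply: key => //.
  have mlf : measurable_fun setT (fun x => l * f x).
    exact: (measurable_funM (measurable_cst _) mf).
  have melf : measurable_fun setT (fun x => e * l * f x).
    exact: (measurable_funM (measurable_cst _) mf).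
  apply: (@le_trans _ _ (\int[@leb R n]_x ((L * e)%:E * phi x `|l * f x|%R))%E).
    apply: ge0_le_integral.
    - exact: measurableT.
    - by move=> x _; exact: phi_ext_ge0 wphi (abse_ge0 _).
    - exact: (weak_Phi_measurable wphi melf).
    - exact: (emeasurable_funM (measurable_cst _) (weak_Phi_measurable wphi mlf)).
    move=> x _ /=; rewrite -mulrA normrM gtr0_norm//.
    exact: HL.
  rewrite ge0_integralZl_EFin.
  - rewrite (_ : (\int[_]_x _)%E = I)// IE -EFinM lee_fin mulrAC.
    by rewrite ler_pdivrMr// mul1r lerDr.
  - exact: measurableT.
  - by move=> x _; exact: (weak_Phi_ge0 wphi).
  - exact: (weak_Phi_measurable wphi mlf).
  - by rewrite mulr_ge0// ltW.
rewrite -lee_pdivrMl ?invr_gt0// invrK.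
(* Each [a] admissible for [f] makes [d^-1 * a] admissible for the maximal function, so the two
   infima compare with factor [d^-1]. *)
apply: le_ereal_inf_tmp => _ [a [a_gt0 ha] <-].
rewrite -[leRHS]mul1e -(divff (lt0r_neq0 d0)) EFinM -muleA; apply: lee_wpmul2l.
  by rewrite lee_fin ltW.
rewrite -EFinM; apply: ereal_inf_lbound; exists (d^-1 * a) => //=; split.
  by rewrite mulr_gt0// invr_gt0.
rewrite (_ : (fun x => _) = (fun x => (d * a^-1)%:E * frac_maximal alpha f x)%E).
  apply: key; first by rewrite invr_gt0.
  rewrite (_ : (fun x => _) = (fun x => (EFin \o f) x * (a^-1)%:E)%E)//.
  by apply/funext => x; rewrite muleC.
by apply/funext => x; rewrite muleC invfM invrK.
Qed.
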